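(* Let $p$ be a prime and let $\chi:\mathbb{Z}\to\overline{\mathbb{Q}}_p$ be a primitive Dirichlet character of conductor $f>1$ with $f$ prime to $p$. Then for every integer $N>0$ prime to $p$ and divisible by $f$, and every integer $r$, \[ L_p(r,\chi\omega^{1-r})=-\frac{1}{N^r}\sum_{k=1}^{N-1}\chi(k)\,\widetilde{\psi}^{(r-1)}_p(k/N). \]
   Context: For an integer $r$, $\widetilde{\psi}_p^{(r)}(z):=\lim_{n\in\mathbb{Z}_{>0},\,n\to z}\sum_{0<k<n,\ p\nmid k}k^{-(r+1)}$ for $z\in\mathbb{Z}_p$ (the $p$-adic polygamma function; the limit is $p$-adic). $\omega$ denotes the Teichmüller character and $L_p(s,\psi)$ the Kubota–Leopoldt $p$-adic $L$-function of a Dirichlet character $\psi$. *)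

(* Defs.v *)
From HB Require Import structures.
From mathcomp Require Import all_boot all_order all_algebra.
From mathcomp Require Import all_classical all_reals.

Set Implicit Arguments.
Unset Strict Implicit.
Unset Printing Implicit Defensive.

Import Order.TTheory GRing.Theory Num.Theory.

Local Open Scope classical_set_scope.
Local Open Scope ring_scope.

Definition in_Qp (R : realType) (K : fieldType) (v : K -> R) (x : K) : Prop :=
  forall e : R, 0 < e -> exists q : rat, v (x - ratr q) < e.

(* [is_Qpbar p v]: the field K with the absolute value v is an algebraic
   closure of Q_p with its p-adic absolute value.  By the first four fields v
   restricts to the p-adic absolute value of Q (in particular K has
   characteristic 0), and by the fifth the closure of Q in K is complete, hence
   is Q_p.  These fields determine (K, v) up to isomorphism. *)
Record is_Qpbar (p : nat) (R : realType) (K : closedFieldType) (v : K -> R) :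
    Prop := {
  Qpbar_eq0 : forall x, v x = 0 <-> x = 0;
  Qpbar_mul : forall x y, v (x * y) = v x * v y;
  Qpbar_ultra : forall x y, v (x + y) <= Num.max (v x) (v y);
  Qpbar_p : v p%:R = p%:R^-1;
  Qpbar_complete : forall u : nat -> rat,
    (forall e : R, 0 < e -> exists M : nat, forall m n : nat,
       (M <= m)%N -> (M <= n)%N -> v (ratr (u m) - ratr (u n)) < e) ->
    exists l : K, forall e : R, 0 < e -> exists M : nat, forall n : nat,
       (M <= n)%N -> v (ratr (u n) - l) < e;
  Qpbar_algebraic : forall x : K, exists P : {poly K},
    [/\ P != 0, (forall i : nat, in_Qp v P`_i) & root P x]
}.

(* u n --> l as the positive integer n tends to z for the absolute value v *)
Definition has_plim (R : realType) (K : fieldType) (v : K -> R)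
    (u : nat -> K) (z l : K) : Prop :=
  forall e : R, 0 < e -> exists2 d : R, 0 < d &
    forall n : nat, (0 < n)%N -> v (n%:R - z) < d -> v (u n - l) < e.

Definition plim (R : realType) (K : fieldType) (v : K -> R)
    (u : nat -> K) (z : K) : K :=
  xget 0 [set l | has_plim v u z l].

Definition polygamma (p : nat) (R : realType) (K : fieldType) (v : K -> R)
    (r : int) (z : K) : K :=
  plim v (fun n => \sum_(1 <= k < n | ~~ (p %| k)%N) k%:R ^ (- (r + 1))) z.

Record dirichlet_character (K : fieldType) (f : nat) (chi : int -> K) :
    Prop := {
  dirichlet_gt0 : (0 < f)%N;
  dirichlet_periodic : forall a : int, chi (a + f%:Z) = chi a;
  dirichlet_mul : forall a b : int, chi (a * b) = chi a * chi b;
  dirichlet_neq0 : forall a : int, (chi a != 0) = coprimez a f%:Z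
}.

(* primitive of conductor f: not induced from any proper divisor of f *)
Definition primitive_character (K : fieldType) (f : nat) (chi : int -> K) :
    Prop :=
  dirichlet_character f chi /\
  forall d : nat, (d %| f)%N -> (d < f)%N ->
    exists a : int, [/\ coprimez a f%:Z, (a = 1 %[mod d%:Z])%Z & chi a != 1].

Definition conductor (K : fieldType) (chi : int -> K) : nat :=
  xget 0%N [set f : nat | primitive_character f chi].

(* For p prime to a, omega(a) is the root of unity of order dividing p - 1
   (2 if p = 2) in Z_p congruent to a modulo p (modulo 4 if p = 2). *)
Definition teichmuller (p : nat) (R : realType) (K : fieldType) (v : K -> R)
    (a : int) : K :=
  let q := if p == 2%N then 4%N else p in
  if (p%:Z %| a)%Z then 0
  else xget 0 [set w : K | w ^+ totient q = 1 /\ v (w - a%:~R) <= v q%:R].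

(* psi * omega^k, products of Dirichlet characters being understood, as usual,
   as the primitive character attached to the pointwise product. *)
Definition twist (p : nat) (R : realType) (K : fieldType) (v : K -> R)
    (psi : int -> K) (k : int) : int -> K :=
  xget psi [set phi : int -> K |
    (exists f : nat, primitive_character f phi) /\
    (forall a : int, ~~ (p%:Z %| a)%Z -> psi a != 0 ->
       phi a = psi a * teichmuller p v a ^ k)].

(* b_0, ..., b_(n-1) with sum_(j <= m) C(m+1, j) b_j = [m = 0] *)
Fixpoint bernoulli_seq (n : nat) : seq rat :=
  if n is m.+1 then
    let s := bernoulli_seq m in
    rcons s (((m == 0%N)%:R - \sum_(j < m) 'C(m.+1, j)%:R * s`_j) / m.+1%:R)
  else [::].

Definition bernoulli (n : nat) : rat := (bernoulli_seq n.+1)`_n.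

Definition bernoulli_poly (n : nat) : {poly rat} :=
  \poly_(i < n.+1) ('C(n, i)%:R * bernoulli (n - i)).

(* B_{n, psi} = f^(n-1) sum_(1 <= a <= f) psi(a) B_n(a/f) for n > 0, where f is
   the conductor of psi *)
Definition gen_bernoulli (K : fieldType) (n : nat) (psi : int -> K) : K :=
  let f := conductor psi in
  f%:R ^+ n.-1 *
  \sum_(1 <= a < f.+1) psi a%:Z * ratr (bernoulli_poly n).[a%:R / f%:R].

(* L_p( . , psi) is the continuous extension to Z_p of the function defined, for
   integers n > 0, by
   1 - n |-> - (1 - psi omega^-n (p) p^(n-1)) B_{n, psi omega^-n} / n
   (to Z_p minus {1} if psi is trivial). *)
Definition Lp (p : nat) (R : realType) (K : fieldType) (v : K -> R)
    (psi : int -> K) (s : K) : K :=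
  plim v (fun n =>
    let phi := twist p v psi (- n%:Z) in
    - (1 - phi p%:Z * p%:R ^+ n.-1) * gen_bernoulli n phi / n%:R) (1 - s).

(* Main.v *)
(** Fix [n > 0], put [t = 1 - r - n], and let [phi] be the primitive character
    attached to [chi * omega^t]; the n-th term of the limit defining [L_p] is
    [-(1 - phi(p) p^(n-1)) B_(n,phi) / n].  Up to [O(p^M)] it is
    [-1 / (n N p^M)] times the sum of [chi(a) omega(a)^t a^n] over
    [0 <= a < N p^M] prime to p.  For [0 <= k < N] choose [m_k] with
    [N m_k = k + p^M c_k].  The [a] congruent to [k] modulo [N] are
    [a = N j - p^M c_k] with [m_k <= j < m_k + p^M].  Expanding [a^n] to first
    order at [N j], and comparing with the sum over [0 <= j < p^M], whose
    contribution is killed by [sum_k chi(k) = 0], one finds modulo higher powers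
    of p that the sum is
    [n N^n p^M omega(N)^t sum_k chi(k) sum_(j < m_k) omega(j)^t j^(n-1)].
    When [n] is p-adically close to [1 - r], the factors
    [omega(j)^t j^(n-1)] and [omega(N)^t N^(n-1)] are uniformly close to
    [j^-r] and [N^-r], and as [m_k] tends to [k / N] the inner sums become the
    values of the polygamma function. *)

Require Import Defs.
From HB Require Import structures.
From mathcomp Require Import all_boot all_order all_algebra.
From mathcomp Require Import all_classical all_reals.
From mathcomp Require Import cyclic zify ring.

Set Implicit Arguments.
Unset Strict Implicit.
Unset Printing Implicit Defensive.

Import Order.TTheory GRing.Theory Num.Theory.
Local Open Scope ring_scope.

(** * The absolute value *)

Section Valuation.
Context (R : realType) (p : nat) (K : closedFieldType) (v : K -> R).
Context (p_prime : prime p) (hK : is_Qpbar p v).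

Local Notation eps L := ((p%:R : R) ^- L).

Lemma v0 : v 0 = 0.
Proof. exact/(Qpbar_eq0 hK). Qed.

Lemma vM x y : v (x * y) = v x * v y.
Proof. exact: Qpbar_mul hK x y. Qed.

Lemma v_eq0 x : (v x == 0) = (x == 0).
Proof. by apply/eqP/eqP => /(Qpbar_eq0 hK). Qed.

Lemma v1 : v 1 = 1.
Proof.
have v1n0 : v 1 != 0 by rewrite v_eq0 oner_eq0.
by apply: (mulfI v1n0); rewrite -vM !mulr1.
Qed.

(* In an algebraically closed field every element is a square. *)
Lemma v_ge0 x : 0 <= v x.
Proof.
have [y yx] : exists y, y ^+ 2 = x.
  have [y] := @solve_monicpoly K 2 (fun i => if i == 0 then x else 0) isT.
  by rewrite big_ord_recl big_ord1 /= mulr1 mul0r addr0; exists y.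
by rewrite -yx expr2 vM sqr_ge0.
Qed.

Lemma v_gt0 x : x != 0 -> 0 < v x.
Proof. by move=> x0; rewrite lt_def v_ge0 v_eq0 x0. Qed.

Lemma vX x n : v (x ^+ n) = v x ^+ n.
Proof. by elim: n => [|n IH]; rewrite ?v1 // !exprS vM IH. Qed.

Lemma vN x : v (- x) = v x.
Proof.
have /eqP : v (-1) ^+ 2 = 1 by rewrite -vX sqrrN expr1n v1.
rewrite sqrf_eq1 => /orP[]/eqP h; first by rewrite -mulN1r vM h mul1r.
by have := v_ge0 (-1); rewrite h ler0N1.
Qed.

Lemma vBC x y : v (x - y) = v (y - x).
Proof. by rewrite -vN opprB. Qed.

Lemma vV x : v x^-1 = (v x)^-1.
Proof.
have [->|x0] := eqVneq x 0; first by rewrite invr0 v0 invr0.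
have vx0 : v x != 0 by rewrite v_eq0.
by apply: (mulfI vx0); rewrite -vM !divff ?v1.
Qed.

Lemma vXz x (z : int) : v (x ^ z) = v x ^ z.
Proof. by case: z => n; rewrite ?NegzE -?exprnN -?exprnP ?vV vX. Qed.

Lemma vD_le e x y : v x <= e -> v y <= e -> v (x + y) <= e.
Proof.
by move=> hx hy; apply: le_trans (Qpbar_ultra hK x y) _; rewrite ge_max hx.
Qed.

Lemma vD_lt e x y : v x < e -> v y < e -> v (x + y) < e.
Proof.
by move=> hx hy; apply: le_lt_trans (Qpbar_ultra hK x y) _; rewrite gt_max hx.
Qed.

Lemma v_trans e y x z : v (x - y) <= e -> v (y - z) <= e -> v (x - z) <= e.
Proof. by move=> h1 h2; rewrite -(subrKA y x); exact: vD_le. Qed.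

Lemma v_trans_lt e y x z : v (x - y) < e -> v (y - z) < e -> v (x - z) < e.
Proof. by move=> h1 h2; rewrite -(subrKA y x); exact: vD_lt. Qed.

Lemma v_sum_le (I : eqType) (s : seq I) (P : pred I) (F : I -> K) e :
  0 <= e -> (forall i, i \in s -> P i -> v (F i) <= e) ->
  v (\sum_(i <- s | P i) F i) <= e.
Proof.
move=> e0 h; rewrite big_seq_cond.
elim/big_ind: _ => [|x y|i /andP[]]; [by rewrite v0|exact: vD_le|exact: h].
Qed.

Lemma v_sum_sub_le (I : eqType) (s : seq I) (P : pred I) (F G : I -> K) e :
  0 <= e -> (forall i, i \in s -> P i -> v (F i - G i) <= e) ->
  v (\sum_(i <- s | P i) F i - \sum_(i <- s | P i) G i) <= e.
Proof. by move=> e0 h; rewrite -sumrB; exact: v_sum_le. Qed.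

Lemma vM_le e x y : v x <= 1 -> v y <= e -> v (x * y) <= e.
Proof.
move=> hx hy; rewrite vM -[leRHS]mul1r; apply: ler_pM => //; exact: v_ge0.
Qed.

Lemma v_nat_le1 n : v n%:R <= 1.
Proof.
by elim: n => [|n IH]; rewrite ?v0 // -natr1 vD_le ?v1.
Qed.

Lemma v_int_le1 (z : int) : v z%:~R <= 1.
Proof.
by case: z => n; rewrite ?NegzE ?mulrNz ?vN -pmulrn; exact: v_nat_le1.
Qed.

(** Isosceles triangle principle: if [v x] were smaller than [v y], then [y = x - (x - y)] would be
    a difference of two elements smaller than itself. *)
Lemma v_eq_of_lt x y : v (x - y) < v y -> v x = v y.
Proof.
move=> h; apply/eqP; rewrite eq_le; apply/andP; split.
  by rewrite -(subrK y x) vD_le // ltW.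
rewrite leNgt; apply/negP => xy.
have : v (x - (x - y)) < v y by rewrite vD_lt // vN.
by rewrite subKr ltxx.
Qed.

Lemma p_gt0 : 0 < p%:R :> R.
Proof. by rewrite ltr0n prime_gt0. Qed.

Lemma eps_gt0 L : 0 < eps L.
Proof. by rewrite invr_gt0 exprn_gt0 ?p_gt0. Qed.

Lemma eps_ge0 L : 0 <= eps L.
Proof. exact/ltW/eps_gt0. Qed.

Lemma eps_le1 L : eps L <= 1.
Proof.
by rewrite invf_le1 ?exprn_gt0 ?p_gt0// exprn_ege1 // ler1n prime_gt0.
Qed.

Lemma le_eps a b : (a <= b)%N -> eps b <= eps a.
Proof.
move=> ab; rewrite lef_pV2 ?posrE ?exprn_gt0 ?p_gt0//.
by rewrite ler_weXn2l // ler1n prime_gt0.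
Qed.

Lemma lt_eps a b : (a < b)%N -> eps b < eps a.
Proof.
move=> ab; rewrite ltf_pV2 ?posrE ?exprn_gt0 ?p_gt0//.
by rewrite ltr_eXn2l // ltr1n prime_gt1.
Qed.

Lemma epsD a b : eps (a + b) = eps a * eps b.
Proof. by rewrite exprD invfM. Qed.

Lemma eps_small (e : R) : 0 < e -> exists L, forall M, (L <= M)%N -> eps M < e.
Proof.
move=> e0; exists (Num.bound e^-1) => M hM.
rewrite invf_plt ?posrE ?exprn_gt0 ?p_gt0//.
apply: lt_trans (archi_boundP _) _; first by rewrite invr_ge0 ltW.
rewrite -natrX ltr_nat; apply: leq_ltn_trans hM _.
exact: ltn_expl (prime_gt1 p_prime).
Qed.

Lemma v_pX L : v (p ^ L)%:R = eps L.
Proof. by rewrite natrX vX (Qpbar_p hK) exprVn. Qed.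

(** If [v a%:~R] were below 1, a Bezout relation between [p] and [a] would write 1 as a sum of two
    elements of absolute value below 1. *)
Lemma v_unit (a : int) : ~~ (p%:Z %| a)%Z -> v a%:~R = 1.
Proof.
move=> pa; apply/eqP; rewrite eq_le v_int_le1 leNgt; apply/negP => h.
have cp : coprimez p%:Z a by rewrite coprimezE /= prime_coprime.
have [[x y] /= xy] := coprimezP _ _ cp.
have /(congr1 (fun z : int => v z%:~R)) := xy.
rewrite rmorphD !rmorphM /= v1 => /eqP; rewrite lt_eqF //.
apply: vD_lt; rewrite vM; last first.
  by apply: le_lt_trans h; rewrite ler_piMl ?v_ge0 ?v_int_le1.
apply: (@le_lt_trans _ _ (v p%:R)).
  by rewrite -pmulrn ler_piMl ?v_ge0 ?v_int_le1.
by rewrite (Qpbar_p hK) invf_lt1 ?p_gt0 // ltr1n prime_gt1.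
Qed.

Lemma v_unit_nat n : ~~ (p %| n)%N -> v n%:R = 1.
Proof. by move=> pn; rewrite pmulrn v_unit. Qed.

Lemma v_nat_eps n : (0 < n)%N -> v n%:R = eps (logn p n).
Proof.
move=> n0; have [m pm hn] := pfactor_coprime p_prime n0.
by rewrite {1}hn natrM vM v_pX v_unit_nat -?prime_coprime // mul1r.
Qed.

Lemma nat_neq0 n : (0 < n)%N -> n%:R != 0 :> K.
Proof. by move=> n0; rewrite -v_eq0 v_nat_eps // gt_eqF ?eps_gt0. Qed.

Lemma int_neq0 (z : int) : z != 0 -> z%:~R != 0 :> K.
Proof.
by case: z => n z0; rewrite ?NegzE ?mulrNz ?oppr_eq0 -pmulrn nat_neq0 ?lt0n.
Qed.

(** Dictionary used throughout: estimates on integers are divisibilities by powers of [p]. *)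
Lemma v_int_le_eps (z : int) L : (v z%:~R <= eps L) = ((p ^ L)%:Z %| z)%Z.
Proof.
have -> : v z%:~R = v `|z|%N%:R.
  by case: z => n; rewrite ?NegzE ?mulrNz ?vN -pmulrn.
rewrite dvdzE /=; have [->|z0] := posnP `|z|%N.
  by rewrite v0 dvdn0 ltW ?eps_gt0.
rewrite v_nat_eps // pfactor_dvdn //.
by have [/le_eps->//|/lt_eps] := leqP L (logn p `|z|%N); rewrite leNgt => ->.
Qed.

Lemma v_nat_le_eps n L : (p ^ L %| n)%N -> v n%:R <= eps L.
Proof. by rewrite pmulrn v_int_le_eps dvdzE. Qed.

Lemma v_subX_le e x y n : v x <= 1 -> v y <= 1 -> v (x - y) <= e ->
  v (x ^+ n - y ^+ n) <= e.
Proof.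
move=> hx hy hxy; rewrite subrXX mulrC; apply: vM_le => //.
apply: v_sum_le => // i _ _.
by rewrite vM !vX mulr_ile1 ?exprn_ile1 ?exprn_ge0 ?v_ge0.
Qed.

Lemma v_subXz_le e x y (z : int) : v x = 1 -> v y = 1 -> v (x - y) <= e ->
  v (x ^ z - y ^ z) <= e.
Proof.
move=> hx hy hxy.
have x0 : x != 0 by rewrite -v_eq0 hx oner_eq0.
have y0 : y != 0 by rewrite -v_eq0 hy oner_eq0.
case: z => n; first by apply: v_subX_le; rewrite ?hx ?hy.
rewrite NegzE -!exprnN.
have -> : x ^- n.+1 - y ^- n.+1 = - ((x ^- n.+1 * y ^- n.+1) * (x ^+ n.+1 - y ^+ n.+1)).
  by field; rewrite !(mulf_neq0, expf_neq0, x0, y0).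
rewrite vN; apply: vM_le; first by rewrite vM !vV !vX hx hy expr1n invr1 mulr1.
by apply: v_subX_le; rewrite ?hx ?hy.
Qed.

(* If v y <= 1/p, every term of (1 + y)^p - 1 is at most v y / p. *)
Lemma v_X_pX x L : v (x - 1) <= eps 1 -> v (x ^+ (p ^ L) - 1) <= eps L.+1.
Proof.
move=> hx; elim: L => [|L IH]; first by rewrite expn0 expr1.
rewrite expnSr exprM; set y := x ^+ _ in IH *.
have hy : v (y - 1) <= eps 1 by apply: le_trans IH (le_eps _).
rewrite -[1 in X in v X](expr1n _ p) subrXX vM.
rewrite -[L.+2]addn1 epsD; apply: ler_pM; rewrite ?v_ge0 //.
have -> : \sum_(i < p) y ^+ (p.-1 - i) * 1 ^+ i =
    \sum_(i < p) (y ^+ (p.-1 - i) - 1) + p%:R.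
  rewrite sumrB big_const_ord iter_addr_0 subrK.
  by apply: eq_bigr => i _; rewrite expr1n mulr1.
apply: vD_le; last by rewrite (Qpbar_p hK) expr1.
have vy : v y <= 1.
  by rewrite -(subrK 1 y) vD_le ?v1 // (le_trans hy) ?eps_le1.
apply: v_sum_le => [|i _ _]; first exact: eps_ge0.
by rewrite -[1 in X in v X](expr1n _ (p.-1 - i)); apply: v_subX_le; rewrite ?v1.
Qed.

(** Powers of a 1-unit are p-adically continuous in the exponent: [x ^+ (p ^ L)] is close to 1, and
    a further integral power keeps it so. *)
Lemma v_Xz_sub1 x (z : int) L : v (x - 1) <= eps 1 ->
  ((p ^ L)%:Z %| z)%Z -> v (x ^ z - 1) <= eps L.
Proof.
move=> hx /dvdzP[m ->]; rewrite mulrC -exprz_exp -exprnP.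
have h : v (x ^+ (p ^ L) - 1) <= eps L.
  by apply: le_trans (v_X_pX _ hx) (le_eps _).
rewrite -[1 in X in v X](exp1rz _ m); apply: v_subXz_le; rewrite ?v1 //.
rewrite vX (_ : v x = 1) ?expr1n // -v1; apply: v_eq_of_lt.
rewrite v1; apply: le_lt_trans hx _.
by have := @lt_eps 0 1 isT; rewrite expr0 invr1.
Qed.

(** Induction on [n]: the new remainder is [x + y] times the old one plus
    [n.+1%:R * x ^+ n * y ^+ 2]. *)
Lemma v_taylorX x y n : v x <= 1 -> v y <= 1 ->
  v ((x + y) ^+ n.+1 - (x ^+ n.+1 + n.+1%:R * x ^+ n * y)) <= v y ^+ 2.
Proof.
move=> hx hy; elim: n => [|n IH].
  by rewrite !expr1 expr0 !mulr1 mul1r subrr v0 exprn_ge0 ?v_ge0.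
have -> : (x + y) ^+ n.+2 - (x ^+ n.+2 + n.+2%:R * x ^+ n.+1 * y) =
  (x + y) * ((x + y) ^+ n.+1 - (x ^+ n.+1 + n.+1%:R * x ^+ n * y))
  + (n.+1%:R * x ^+ n) * y ^+ 2.
  by rewrite !exprS -!natr1; ring.
apply: vD_le; apply: vM_le; rewrite ?IH ?vD_le // ?vX //.
by rewrite vM vX mulr_ile1 ?exprn_ge0 ?exprn_ile1 ?v_ge0 ?v_nat_le1.
Qed.

(** Positive integers have nonzero absolute value, so [K] has characteristic 0 and equal fractions
    of integers stay equal in [K]. The morphism carries Bernoulli identities from the rationals to
    [K]. *)
Lemma ratr_rmorphism : exists f : {rmorphism rat -> K}, f =1 ratr.
Proof.
have nzd (x : rat) : (denq x)%:~R != 0 :> K by rewrite int_neq0 ?denq_neq0.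
have key (a b c d : int) : b != 0 -> d != 0 ->
    a%:~R / b%:~R = c%:~R / d%:~R :> rat ->
    a%:~R / b%:~R = c%:~R / d%:~R :> K.
  move=> b0 d0 /eqP; rewrite !eqr_div ?intr_eq0 // -!intrM eqr_int => /eqP h.
  by apply/eqP; rewrite eqr_div ?int_neq0 // -!intrM h.
have ratrE (x : rat) (a b : int) : b != 0 -> x = a%:~R / b%:~R ->
    ratr x = a%:~R / b%:~R :> K.
  by move=> b0 h; apply: key => //; rewrite ?denq_neq0 // divq_num_den.
have add : zmod_morphism (ratr : rat -> K).
  move=> x y; rewrite (ratrE _ (numq x * denq y - numq y * denq x) (denq x * denq y)).
  - by rewrite /ratr rmorphB !rmorphM /=; field; rewrite !nzd.
  - by rewrite mulf_neq0 ?denq_neq0.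
  rewrite -{1}(divq_num_den x) -{1}(divq_num_den y) rmorphB !rmorphM /=.
  by field; rewrite !intr_eq0 !denq_neq0.
have mul : monoid_morphism (ratr : rat -> K).
  split=> [|x y]; first exact: (ratr_nat _ 1).
  rewrite (ratrE _ (numq x * numq y) (denq x * denq y)).
  - by rewrite /ratr !rmorphM /=; field; rewrite !nzd.
  - by rewrite mulf_neq0 ?denq_neq0.
  rewrite -{1}(divq_num_den x) -{1}(divq_num_den y) !rmorphM /=.
  by field; rewrite !intr_eq0 !denq_neq0.
pose fA := GRing.isZmodMorphism.Build _ _ _ add.
pose fM := GRing.isMonoidMorphism.Build _ _ _ mul.
by exists (HB.pack_for {rmorphism rat -> K} (ratr : rat -> K) fA fM).
Qed.

(** The first hypothesis makes the condition in [has_plim] non-vacuous: at an integer close enough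
    to [z], two candidate limits are closer to each other than their own distance. *)
Lemma plimE (u : nat -> K) z l :
  (forall L, exists2 n, (0 < n)%N & v (n%:R - z) <= eps L) ->
  has_plim v u z l -> plim v u z = l.
Proof.
move=> hz hl; apply: xget_unique => // l' hl'.
apply/eqP; rewrite -subr_eq0 -v_eq0; apply/contraT => ne.
have e0 : 0 < v (l' - l) by rewrite lt_def ne v_ge0.
have [d d0 hd] := hl _ e0; have [d' d'0 hd'] := hl' _ e0.
have [L hL] := eps_small d0; have [L' hL'] := eps_small d'0.
have [n n0 hn] := hz (maxn L L').
have := @v_trans_lt (v (l' - l)) (u n) l' l.
rewrite ltxx vBC => -> //.
  by apply: hd' => //; apply: le_lt_trans hn _; rewrite hL' ?leq_maxr.
by apply: hd => //; apply: le_lt_trans hn _; rewrite hL ?leq_maxl.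
Qed.

End Valuation.

(** * Dirichlet characters *)

Section Coprimality.
Implicit Types (a b d F M : int).

Lemma coprimez_mod a b F : (a = b %[mod F])%Z -> coprimez a F = coprimez b F.
Proof. by move=> ab; rewrite /coprimez -gcdz_modl ab gcdz_modl. Qed.

Lemma eqz_modP a b F : (exists k, a - b = k * F) -> (a = b %[mod F])%Z.
Proof. by move=> [k h]; apply/eqP; rewrite eqz_mod_dvd h dvdz_mull. Qed.

(** Take for [i] the product of the primes dividing [M] but not [a]. A prime of [M] divides exactly
    one of [a] and [i], and one that divides [a] does not divide [F], so none divides
    [a + i * F]. *)
Lemma coprimez_shift a F M : M != 0 -> coprimez a F ->
  exists i, coprimez (a + i * F) M.
Proof.
move=> M0 cop.
pose i := (\prod_(l <- primes `|M| | ~~ (l%:Z %| a)%Z) l)%N.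
exists i%:Z; apply/negPn/negP => ncop; set b := a + i%:Z * F in ncop.
have M0' : (0 < `|M|)%N by rewrite absz_gt0.
have g1 : (1 < gcdn `|b| `|M|)%N.
  by rewrite ltn_neqAle eq_sym ncop gcdn_gt0 M0' orbT.
have lp := pdiv_prime g1; set l := pdiv _ in lp.
have := pdiv_dvd (gcdn `|b| `|M|); rewrite -/l dvdn_gcd => /andP[lb lM].
have {}lb : (l%:Z %| b)%Z by [].
have [la|la] := boolP (l%:Z %| a)%Z.
  have : (l%:Z %| i%:Z * F)%Z.
    have -> : i%:Z * F = b - a by rewrite /b; ring.
    exact: rpredB.
  rewrite dvdzE abszM Euclid_dvdM // => /orP[|lF].
    rewrite /= Euclid_dvd_prod // big_has_cond => /hasP[l' l'M /andP[l'a]].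
    have l'p : prime l' by move: l'M; rewrite mem_primes => /andP[].
    by rewrite dvdn_prime2 // => /eqP ll'; rewrite -ll' la in l'a.
  have : (l %| gcdn `|a| `|F|)%N by rewrite dvdn_gcd lF andbT; exact: la.
  have /eqP -> : gcdn `|a| `|F| == 1%N by [].
  by rewrite dvdn1 gtn_eqF // prime_gt1.
have lip : (l %| i)%N.
  have lMp : l \in primes `|M| by rewrite mem_primes lp M0' lM.
  by rewrite /i big_mkcond (bigD1_seq l lMp (primes_uniq _)) /= la dvdn_mulr.
have : (l%:Z %| a)%Z.
  have -> : a = b - i%:Z * F by rewrite /b; ring.
  by rewrite rpredB // dvdz_mulr.
by rewrite (negPf la).
Qed.

(** A Bezout relation for [gcdz F M] splits [a - b] into a multiple of [F] plus a multiple of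
    [M]. *)
Lemma chinese_gcdz a b F M : (gcdz F M %| a - b)%Z ->
  exists c, (c = a %[mod F])%Z /\ (c = b %[mod M])%Z.
Proof.
move=> /dvdzP[k hk]; have [x [y hxy]] := Bezoutz F M.
exists (a - x * F * k); split; apply: eqz_modP.
  by exists (- x * k); ring.
exists (y * k).
have -> : a = b + k * gcdz F M by rewrite -hk; ring.
by rewrite -hxy; ring.
Qed.

End Coprimality.

(** * Dirichlet characters: primitivity, uniqueness, products and vanishing sums *)

Section Characters.
Context (K : fieldType).
Implicit Types (chi : int -> K) (f : nat) (a b : int).

Lemma dirichlet_mod chi f a b : dirichlet_character f chi ->
  (a = b %[mod f%:Z])%Z -> chi a = chi b.
Proof.
move=> hchi /eqP; rewrite eqz_mod_dvd => /dvdzP[k hk].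
have -> : a = b + k * f%:Z by rewrite -hk; ring.
have per n c : chi (c + n%:Z * f%:Z) = chi c.
  elim: n c => [|n IH] c; first by rewrite mul0r addr0.
  by rewrite -[in RHS](IH c) -[RHS](dirichlet_periodic hchi); congr chi; ring.
case: k {hk} => n; first exact: per.
by rewrite -[LHS](per n.+1) NegzE; congr chi; ring.
Qed.

Lemma dirichlet1 chi f : dirichlet_character f chi -> chi 1 = 1.
Proof.
move=> hchi; have h : chi 1 != 0.
  by rewrite (dirichlet_neq0 hchi) /coprimez gcd1z.
by apply: (mulfI h); rewrite -(dirichlet_mul hchi) !mulr1.
Qed.

Lemma dirichlet_eq0 chi f a : dirichlet_character f chi ->
  ~~ coprimez a f%:Z -> chi a = 0.
Proof. by move=> hchi; rewrite -(dirichlet_neq0 hchi) negbK => /eqP. Qed.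

Lemma dirichletX chi f a n : dirichlet_character f chi ->
  chi (a ^+ n) = chi a ^+ n.
Proof.
move=> hchi; elim: n => [|n IH]; first by rewrite !expr0 (dirichlet1 hchi).
by rewrite !exprS (dirichlet_mul hchi) IH.
Qed.

Lemma eulerz a f : (0 < f)%N -> coprimez a f%:Z ->
  (a ^+ totient f = 1 %[mod f%:Z])%Z.
Proof.
move=> f0 cop; pose n := `|(a %% f%:Z)%Z|%N.
have nE : n%:Z = (a %% f%:Z)%Z by rewrite gez0_abs // modz_ge0 // eqz_nat -lt0n.
have cn : coprime n f.
  by have := cop; rewrite /coprimez -gcdz_modl -nE.
have nX : n%:Z ^+ totient f = (n ^ totient f)%N%:Z.
  by rewrite -!natz -natrX.
by rewrite -modzXm -nE nX -[1]/(1%N%:Z) !modz_nat Euler_exp_totient.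
Qed.

Lemma dirichlet_root1 chi f a : dirichlet_character f chi ->
  coprimez a f%:Z -> chi a ^+ totient f = 1.
Proof.
move=> hchi cop; rewrite -(dirichletX _ _ hchi) -(dirichlet1 hchi).
exact/(dirichlet_mod hchi)/eulerz/cop/(dirichlet_gt0 hchi).
Qed.

(** Otherwise [gcdn f f'] is a proper divisor of [f], and primitivity gives [a] congruent to 1
    modulo it with [chi a != 1]. Lift [a] to a class that is [a] modulo [f] and 1 modulo [f'], and
    move it to be prime to [M]: there [chi] and [chi'] agree, so [chi a = 1]. *)
Lemma primitive_dvd chi f chi' f' (M : int) : M != 0 ->
  primitive_character f chi -> dirichlet_character f' chi' ->
  (forall a, coprimez a M -> chi a = chi' a) -> (f %| f')%N.
Proof.
move=> M0 [hchi prim] hchi' eqM.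
have [lt|] := ltnP (gcdn f f') f; last first.
  rewrite leq_eqVlt ltnNge dvdn_leq ?dvdn_gcdl ?(dirichlet_gt0 hchi) // orbF.
  by move=> /eqP ->; exact: dvdn_gcdr.
have [a [cop a1 /eqP[]]] := prim _ (dvdn_gcdl _ _) lt.
have [|c [ca c1]] := @chinese_gcdz a 1 f f'.
  by rewrite -eqz_mod_dvd; exact/eqP.
have copc : coprimez c (f%:Z * f'%:Z).
  rewrite coprimezMr (coprimez_mod ca) cop (coprimez_mod c1) /coprimez.
  by rewrite gcd1z.
have [i cM] := coprimez_shift M0 copc.
rewrite -(dirichlet1 hchi'); transitivity (chi (c + i * (f%:Z * f'%:Z))).
  apply: (dirichlet_mod hchi); rewrite -ca; apply: eqz_modP.
  by exists (- i * f'%:Z); ring.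
rewrite eqM //; apply: (dirichlet_mod hchi'); rewrite -c1; apply: eqz_modP.
by exists (i * f%:Z); ring.
Qed.

(** The conductors divide each other; then every class prime to [f] has a representative prime to
    [M], where the values agree. *)
Lemma primitive_unique chi f chi' f' (M : int) : M != 0 ->
  primitive_character f chi -> primitive_character f' chi' ->
  (forall a, coprimez a M -> chi a = chi' a) -> chi = chi'.
Proof.
move=> M0 prim prim' eqM; have [hchi _] := prim; have [hchi' _] := prim'.
have ff' : f = f'.
  apply/eqP; rewrite eqn_dvd (primitive_dvd M0 prim hchi' eqM) /=.
  by apply: (primitive_dvd M0 prim' hchi) => a /eqM.
rewrite -{f'}ff' in hchi' {prim'}; apply/funext => a.
have [cop|ncop] := boolP (coprimez a f%:Z); last first.
  by rewrite (dirichlet_eq0 hchi) // (dirichlet_eq0 hchi').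
have [i cM] := coprimez_shift M0 cop.
have e : (a + i * f%:Z = a %[mod f%:Z])%Z by apply: eqz_modP; exists i; ring.
by rewrite -(dirichlet_mod hchi e) eqM // (dirichlet_mod hchi' e).
Qed.

Lemma conductorE chi f : primitive_character f chi -> conductor chi = f.
Proof.
move=> prim; apply: xget_unique => // g [hg primg]; have [hf _] := prim.
apply/eqP; rewrite eqn_dvd (@primitive_dvd chi g chi f 1) //.
by rewrite (@primitive_dvd chi f chi g 1).
Qed.

Lemma dirichlet_prod chi f theta g :
  dirichlet_character f chi -> dirichlet_character g theta ->
  dirichlet_character (f * g) (fun a => chi a * theta a).
Proof.
move=> hf hg; split=> [|a|a b|a].
- by rewrite muln_gt0 (dirichlet_gt0 hf) (dirichlet_gt0 hg).
- congr (_ * _); [apply: (dirichlet_mod hf)|apply: (dirichlet_mod hg)];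
    apply: eqz_modP; [exists g%:Z|exists f%:Z]; rewrite PoszM; ring.
- by rewrite (dirichlet_mul hf) (dirichlet_mul hg) mulrACA.
- by rewrite mulf_eq0 negb_or (dirichlet_neq0 hf) (dirichlet_neq0 hg) PoszM coprimezMr.
Qed.

(** Primitivity of [chi] at [gcdn d f] gives [a]; the Chinese remainder theorem replaces it by [c],
    equal to [a] modulo [f] and to 1 modulo [g], so that [theta] contributes 1. Then [c] is 1 modulo
    [gcdn d f * g], a multiple of [d]. *)
Lemma primitive_prod_aux chi f theta g d :
  coprime f g -> primitive_character f chi -> dirichlet_character g theta ->
  (d %| f * g)%N -> (gcdn d f < f)%N ->
  exists a, [/\ coprimez a (f * g)%N%:Z, (a = 1 %[mod d%:Z])%Z
              & chi a * theta a != 1].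
Proof.
move=> cop [hf primf] hg dfg lt.
have [a [copa a1 chia]] := primf _ (dvdn_gcdr _ _) lt.
have [|c [ca c1]] := @chinese_gcdz a 1 f g.
  by have /eqP := cop; rewrite /gcdz => ->; rewrite dvd1z.
exists c; split.
- rewrite PoszM coprimezMr (coprimez_mod ca) copa (coprimez_mod c1).
  by rewrite /coprimez gcd1z.
- apply/eqP; rewrite eqz_mod_dvd; apply: (@dvdz_trans (gcdn d f * g)%N).
    by rewrite dvdzE /= muln_gcdl dvdn_gcd dvdn_mulr.
  rewrite dvdzE /= Gauss_dvd; last first.
    exact: coprime_dvdl (dvdn_gcdr _ _) cop.
  apply/andP; split; last first.
    by have /eqP := c1; rewrite eqz_mod_dvd dvdzE.
  suff : (c == 1 %[mod gcdn d f])%Z by rewrite eqz_mod_dvd dvdzE.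
  rewrite -a1 eqz_mod_dvd; apply: (@dvdz_trans f%:Z).
    by rewrite dvdzE dvdn_gcdr.
  by have /eqP := ca; rewrite eqz_mod_dvd.
- by rewrite (dirichlet_mod hf ca) (dirichlet_mod hg c1) (dirichlet1 hg) mulr1.
Qed.

(** A proper divisor [d] of [f * g] misses part of [f] or part of [g], since otherwise both, being
    coprime, would have their product divide [d]. The auxiliary lemma applies to the factor
    concerned. *)
Lemma primitive_prod chi f theta g : coprime f g ->
  primitive_character f chi -> primitive_character g theta ->
  primitive_character (f * g) (fun a => chi a * theta a).
Proof.
move=> cop hchi htheta; have [hf _] := hchi; have [hg _] := htheta.
split=> [|d dfg lt]; first exact: dirichlet_prod.
have [lef|] := leqP f (gcdn d f); last exact: primitive_prod_aux.
have [leg|ltg] := leqP g (gcdn d g); last first.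
  have [||a [h1 h2 h3]] := @primitive_prod_aux theta g chi f d _ htheta hf _ ltg.
  - by rewrite coprime_sym.
  - by rewrite mulnC.
  by exists a; split; rewrite 1?mulnC 1?mulrC.
have dvd x : (0 < x)%N -> (x <= gcdn d x)%N -> (x %| d)%N.
  move=> x0; rewrite leq_eqVlt ltnNge dvdn_leq ?dvdn_gcdr // orbF.
  by move=> /eqP ->; exact: dvdn_gcdl.
have : (f * g %| d)%N.
  by rewrite Gauss_dvd // !dvd ?(dirichlet_gt0 hf) ?(dirichlet_gt0 hg).
have d0 : (0 < d)%N.
  by move: (lt) dfg; case: (d) => // lt0; rewrite dvd0n (gtn_eqF lt0).
by move/(dvdn_leq d0); rewrite leqNgt lt.
Qed.

(** Multiplication by [b] permutes the residues modulo [f], so the sum [S] satisfies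
    [chi b * S = S]. *)
Lemma sum_dirichlet0 chi f b : dirichlet_character f chi ->
  coprimez b f%:Z -> chi b != 1 -> \sum_(0 <= k < f) chi k%:Z = 0.
Proof.
move=> hchi cop chib; have f0 := dirichlet_gt0 hchi.
have fz0 : f%:Z != 0 by rewrite eqz_nat -lt0n.
rewrite big_mkord; set S := \sum_(i < f) _.
have hlt (i : 'I_f) : (`|(b * i%:Z %% f%:Z)%Z| < f)%N.
  by rewrite -ltz_nat gez0_abs ?modz_ge0 // ltz_pmod.
pose h i := Ordinal (hlt i).
have hE i : (h i)%:Z = (b * i%:Z %% f%:Z)%Z by rewrite gez0_abs ?modz_ge0.
have injh : injective h.
  move=> i j hij; apply/val_inj => /=.
  have /eqP : (b * i%:Z %% f%:Z)%Z = (b * j%:Z %% f%:Z)%Z by rewrite -!hE hij.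
  rewrite eqz_mod_dvd -mulrBr Gauss_dvdzr 1?coprimez_sym // -eqz_mod_dvd.
  by rewrite !modz_small ?ltz_nat ?ltn_ord // => /eqP[].
have : chi b * S = S.
  rewrite /S mulr_sumr [RHS](reindex_inj injh); apply: eq_bigr => i _.
  rewrite -(dirichlet_mul hchi); apply: (dirichlet_mod hchi).
  by rewrite hE modz_mod.
move=> /eqP; rewrite -subr_eq0 -[X in _ - X]mul1r -mulrBl mulf_eq0.
by rewrite subr_eq0 (negPf chib) => /eqP.
Qed.

Lemma sum_primitive0 chi f N : primitive_character f chi -> (1 < f)%N ->
  (f %| N)%N -> \sum_(0 <= k < N) chi k%:Z = 0.
Proof.
move=> [hchi prim] f1 /dvdnP[m ->].
(* Primitivity at the divisor 1 says that [chi] is not trivial. *)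
have [b [cop _ chib]] := prim 1%N (dvd1n f) f1.
rewrite big_nat_mul big1 // => i _; rewrite -[RHS](sum_dirichlet0 hchi cop chib).
rewrite mulSn -{1}[(i * f)%N]add0n big_addn addnK; apply: eq_bigr => k _.
apply: (dirichlet_mod hchi); apply: eqz_modP.
by exists i%:Z; rewrite PoszD PoszM; ring.
Qed.

End Characters.

(** * The Teichmuller character and twists *)

Section Teichmuller.
Context (R : realType) (p : nat) (K : closedFieldType) (v : K -> R).
Context (p_prime : prime p) (hK : is_Qpbar p v).
Implicit Types (a b t : int).

Local Notation eps L := ((p%:R : R) ^- L).
Local Notation q := (if p == 2%N then 4%N else p).
Local Notation om := (teichmuller p v).

Lemma teich_modulus_gt0 : (0 < q)%N.
Proof. by case: ifP => // _; exact: prime_gt0. Qed.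

Lemma dvdn_p_teich_modulus : (p %| q)%N.
Proof. by case: eqP => [->|]. Qed.

Lemma dvdn_teich_modulus_sqr : (q %| p ^ 2)%N.
Proof. by case: eqP => [->|_] //; rewrite dvdn_exp. Qed.

Lemma coprimez_teich_modulus a : coprimez a q%:Z = ~~ (p%:Z %| a)%Z.
Proof.
have -> : ~~ (p%:Z %| a)%Z = coprimez a p%:Z.
  by rewrite coprimez_sym coprimezE /= prime_coprime.
apply/idP/idP; first by apply: coprimez_dvdr; exact: dvdn_p_teich_modulus.
move=> cop; apply: (coprimez_dvdr dvdn_teich_modulus_sqr).
by rewrite coprimezE coprimeXr.
Qed.

Lemma v_teich_modulus_le : v q%:R <= eps 1.
Proof. by apply: (v_nat_le_eps p_prime hK); rewrite dvdn_p_teich_modulus. Qed.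

(** The gap that separates roots of unity modulo [q]: 1/4 against 1/2 for [p = 2], and 1/p against 1
    for odd [p]. *)
Lemma v_teich_modulus_lt : v q%:R < v (totient q)%:R.
Proof.
case: eqP => [p2|/eqP p2].
  have -> : 4%N = (p ^ 2)%N by rewrite p2.
  have -> : totient (p ^ 2) = (p ^ 1)%N by rewrite p2.
  by rewrite !(v_pX hK) lt_eps.
have p_gt2 : (2 < p)%N by rewrite ltn_neqAle eq_sym p2 prime_gt1.
rewrite (Qpbar_p hK) (v_unit_nat p_prime hK).
  by rewrite invf_lt1 ?p_gt0 // ltr1n prime_gt1.
rewrite totient_prime //; apply/negP => /dvdn_leq; lia.
Qed.

Lemma v_root1 w n : (0 < n)%N -> w ^+ n = 1 -> v w = 1.
Proof.
move=> n0 wn; apply/eqP; rewrite -(@pexpr_eq1 _ _ n) ?(v_ge0 hK) //.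
by rewrite -(vX hK) wn (v1 hK).
Qed.

(** The sum is the cofactor of [x - y] in [x ^+ n - y ^+ n]; replacing each [y ^+ i] by [x ^+ i]
    changes it by at most [v (x - y)]. *)
Lemma v_geometric x y n : v x = 1 -> v y <= 1 ->
  v (\sum_(i < n) x ^+ (n.-1 - i) * y ^+ i - n%:R * x ^+ n.-1) <= v (x - y).
Proof.
move=> hx hy.
have -> : n%:R * x ^+ n.-1 = \sum_(i < n) x ^+ (n.-1 - i) * x ^+ i.
  rewrite mulr_natl -[X in _ *+ X]card_ord -sumr_const.
  apply: eq_bigr => i _; rewrite -exprD subnK //.
  by case: (n) i => [[]//|m] i; rewrite -ltnS.
apply: (v_sum_sub_le hK) => [|i _ _]; first exact: v_ge0 hK _.
rewrite -mulrBr; apply: (vM_le hK); first by rewrite (vX hK) hx expr1n.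
by apply: (v_subX_le hK); rewrite ?hx // (vBC hK).
Qed.

(** For distinct roots the geometric cofactor vanishes, which forces
    [v (totient q)%:R <= v (w - w')], against the gap above. *)
Lemma teich_unique w w' : w ^+ totient q = 1 -> w' ^+ totient q = 1 ->
  v (w - w') <= v q%:R -> w = w'.
Proof.
move=> hw hw' ww'; apply/eqP; rewrite -subr_eq0; apply/contraT => ne.
have n0 : (0 < totient q)%N by rewrite totient_gt0 teich_modulus_gt0.
have vw := v_root1 n0 hw; have vw' := v_root1 n0 hw'.
have := subrXX w w' (totient q).
rewrite hw hw' subrr => /esym/eqP; rewrite mulf_eq0 (negPf ne) /= => /eqP e.
have := @v_geometric w w' (totient q) vw.
rewrite vw' lexx e sub0r (vN hK) (vM hK) (vX hK) vw expr1n mulr1 => /(_ isT).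
by move=> /le_trans/(_ ww'); rewrite leNgt v_teich_modulus_lt.
Qed.

(** For odd [p] no Hensel lifting is required: [K] contains all roots of [X^(p-1) - 1], and the one
    nearest to [a] works. *)
Lemma teich_exists a : ~~ (p%:Z %| a)%Z ->
  exists w : K, w ^+ totient q = 1 /\ v (w - a%:~R) <= v q%:R.
Proof.
move=> pa; have [p2|p2] := eqVneq p 2%N.
  (* For [p = 2] an odd integer is 1 or -1 modulo 4. *)
  rewrite p2 in pa *; have -> : totient 4 = 2%N by [].
  have v4 (z : int) : (4%:Z %| z)%Z -> v z%:~R <= v 4%:R.
    have -> : 4%N = (p ^ 2)%N by rewrite p2.
    by move=> h; rewrite (v_pX hK) (v_int_le_eps p_prime hK).
  have [a1|a1] := boolP (4%:Z %| 1 - a)%Z.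
    by exists 1; rewrite expr1n; split=> //; have := v4 _ a1; rewrite rmorphB.
  exists (-1); rewrite sqrrN expr1n; split => //.
  by have -> : -1 - a%:~R = (-1 - a)%:~R :> K; [rewrite rmorphB|apply: v4; lia].
have n0 : (0 < totient p)%N by rewrite totient_gt0 prime_gt0.
have va := v_unit p_prime hK pa.
have vn : v (totient p)%:R = 1.
  apply: (v_unit_nat p_prime hK).
  have p_gt2 : (2 < p)%N by rewrite ltn_neqAle eq_sym p2 prime_gt1.
  rewrite totient_prime //; apply/negP => /dvdn_leq; lia.
have van : v (a%:~R ^+ totient p - 1) <= v p%:R.
  have -> : a%:~R ^+ totient p - 1 = (a ^+ totient p - 1)%:~R :> K.
    by rewrite rmorphB rmorphXn.
  have -> : v p%:R = eps 1 by rewrite (Qpbar_p hK) expr1.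
  rewrite (v_int_le_eps p_prime hK) expn1 -eqz_mod_dvd; apply/eqP/eulerz.
    exact: prime_gt0.
  by rewrite coprimez_sym coprimezE /= prime_coprime.
have vp1 : v p%:R < 1.
  by rewrite (Qpbar_p hK) invf_lt1 ?p_gt0 // ltr1n prime_gt1.
have [rs hrs] := closed_field_poly_normal ('X^(totient p) - 1 : {poly K}).
have lead : lead_coef ('X^(totient p) - 1 : {poly K}) = 1.
  by apply/eqP; exact: monicXnsubC.
rewrite lead scale1r in hrs.
(* If every root were at distance at least 1 from [a], so would be the product of the differences,
   which is [a ^+ totient p - 1]. *)
have [w wrs wa] : exists2 w, w \in rs & v (a%:~R - w) < 1.
  apply: contrapT => hno.
  have : v (a%:~R ^+ totient p - 1) < 1 by apply: le_lt_trans vp1.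
  have -> : a%:~R ^+ totient p - 1 = \prod_(z <- rs) (a%:~R - z).
    have := congr1 (fun P => P.[a%:~R]) hrs; rewrite !hornerE horner_prod.
    by move=> ->; apply: eq_bigr => z _; rewrite !hornerE.
  apply/negP; rewrite -leNgt; rewrite big_seq.
  elim/big_ind: _ => [|x y hx hy|z zrs]; first by rewrite (v1 hK).
    by rewrite (vM hK) mulr_ege1.
  by rewrite leNgt; apply/negP => h; apply: hno; exists z.
have wn : w ^+ totient p = 1.
  have : root ('X^(totient p) - 1) w by rewrite hrs root_prod_XsubC.
  by rewrite /root !hornerE subr_eq0 => /eqP.
exists w; split=> //; rewrite (vBC hK).
have := @v_geometric a%:~R w (totient p) va.
rewrite (v_root1 n0 wn) lexx => /(_ isT) hg.
(* The cofactor of [a - w] is close to [(p - 1) a^(p-2)], hence a unit, so [a - w] is as small as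
   [a ^+ totient p - 1]. *)
have vg : v (\sum_(i < totient p) a%:~R ^+ ((totient p).-1 - i) * w ^+ i) = 1.
  have e : v ((totient p)%:R * a%:~R ^+ (totient p).-1) = 1.
    by rewrite (vM hK) (vX hK) va expr1n vn mulr1.
  by rewrite -[RHS]e; apply: (v_eq_of_lt hK); rewrite e; exact: le_lt_trans wa.
move: van; have := subrXX a%:~R w (totient p); rewrite wn => ->.
by rewrite (vM hK) vg mulr1.
Qed.

Lemma teichP a : ~~ (p%:Z %| a)%Z ->
  om a ^+ totient q = 1 /\ v (om a - a%:~R) <= v q%:R.
Proof.
by move=> pa; rewrite /teichmuller (negPf pa); exact: (xgetPex _ (teich_exists pa)).
Qed.

Lemma teichE a w : ~~ (p%:Z %| a)%Z -> w ^+ totient q = 1 ->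
  v (w - a%:~R) <= v q%:R -> om a = w.
Proof.
move=> pa wn wa; have [h1 h2] := teichP pa; apply: teich_unique => //.
by apply: (v_trans hK h2); rewrite (vBC hK).
Qed.

Lemma v_teich a : ~~ (p%:Z %| a)%Z -> v (om a) = 1.
Proof.
move=> /teichP[h _]; apply: v_root1 h.
by rewrite totient_gt0 teich_modulus_gt0.
Qed.

Lemma teich_neq0 a : ~~ (p%:Z %| a)%Z -> om a != 0.
Proof. by move=> pa; rewrite -(v_eq0 hK) v_teich // oner_eq0. Qed.

Lemma p_Euclid a b : (p%:Z %| a * b)%Z = (p%:Z %| a)%Z || (p%:Z %| b)%Z.
Proof. by rewrite !dvdzE abszM Euclid_dvdM. Qed.

Lemma teichM a b : om (a * b) = om a * om b.
Proof.
have [pa|pa] := boolP (p%:Z %| a)%Z.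
  by rewrite /teichmuller p_Euclid pa mul0r.
have [pb|pb] := boolP (p%:Z %| b)%Z.
  by rewrite /teichmuller p_Euclid pb orbT mulr0.
have [a1 a2] := teichP pa; have [b1 b2] := teichP pb.
apply: teichE; first by rewrite p_Euclid negb_or pa.
  by rewrite exprMn a1 b1 mulr1.
have -> : om a * om b - (a * b)%:~R =
    om a * (om b - b%:~R) + b%:~R * (om a - a%:~R) by rewrite rmorphM /=; ring.
apply: (vD_le hK); apply: (vM_le hK) => //; first by rewrite v_teich.
exact: (v_int_le1 hK).
Qed.

Lemma v_teich_modulus_dvd (z : int) : (q%:Z %| z)%Z -> v z%:~R <= v q%:R.
Proof.
move=> /dvdzP[k ->]; rewrite rmorphM /=; apply: (vM_le hK) => //.
exact: (v_int_le1 hK).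
Qed.

Lemma dvdp_mod a b : (a = b %[mod q%:Z])%Z -> (p%:Z %| a)%Z = (p%:Z %| b)%Z.
Proof.
move=> /coprimez_mod h; apply: negb_inj.
by rewrite -!coprimez_teich_modulus h.
Qed.

Lemma teich_mod a b : (a = b %[mod q%:Z])%Z -> om a = om b.
Proof.
move=> ab; have [pb|pb] := boolP (p%:Z %| b)%Z.
  by rewrite /teichmuller (dvdp_mod ab) pb.
have [b1 b2] := teichP pb; apply: teichE => //; first by rewrite (dvdp_mod ab).
apply: (v_trans hK b2); rewrite -rmorphB /=; apply: v_teich_modulus_dvd.
by rewrite -eqz_mod_dvd; apply/eqP.
Qed.

(** Setting the value to 0 at multiples of [p] matters for [t = 0], where [0 ^ 0] would be 1; this
    way every [t] gives a Dirichlet character modulo [q]. *)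
Definition teich_pow t a : K := if (p%:Z %| a)%Z then 0 else om a ^ t.

Lemma teich_pow_dirichlet t : dirichlet_character q (teich_pow t).
Proof.
split=> [|a|a b|a].
- exact: teich_modulus_gt0.
- have e : (a + q%:Z = a %[mod q%:Z])%Z by apply: eqz_modP; exists 1; ring.
  by rewrite /teich_pow (dvdp_mod e) (teich_mod e).
- rewrite /teich_pow p_Euclid teichM.
  case: (boolP (p%:Z %| a)%Z) => pa /=; first by rewrite mul0r.
  case: (boolP (p%:Z %| b)%Z) => pb /=; first by rewrite mulr0.
  by rewrite exprzMl ?unitfE ?teich_neq0.
- rewrite coprimez_teich_modulus /teich_pow.
  case: (boolP (p%:Z %| a)%Z) => pa; first by rewrite eqxx.
  by rewrite expfz_neq0 ?teich_neq0.
Qed.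

Lemma v_teich_pow t a : v (teich_pow t a) <= 1.
Proof.
rewrite /teich_pow; case: ifPn => pa; first by rewrite (v0 hK).
by rewrite (vXz hK) v_teich // exp1rz.
Qed.

(** A proper divisor of [q] is 1, or divides 2 when [p = 2]; every integer prime to [p] is 1 modulo
    it, so any witness of nontriviality will do. *)
Lemma teich_pow_primitive t a : ~~ (p%:Z %| a)%Z -> om a ^ t != 1 ->
  primitive_character q (teich_pow t).
Proof.
move=> pa oma; split=> [|d dq ltd]; first exact: teich_pow_dirichlet.
exists a; split; [by rewrite coprimez_teich_modulus| |by rewrite /teich_pow (negPf pa)].
have [p2|p2] := eqVneq p 2%N.
  rewrite p2 in pa dq ltd *; have d2 : (d %| 2)%N by move: d dq ltd; do 4![case=> //].
  apply/eqP; rewrite eqz_mod_dvd; apply: (@dvdz_trans 2%:Z); first exact: d2.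
  lia.
rewrite (negPf p2) in dq ltd; have /primeP[_ /(_ _ dq)] := p_prime; rewrite (ltn_eqF ltd) orbF => /eqP ->.
by rewrite !modz1.
Qed.

(* As the conductor of [chi] is prime to p, the primitive character
   [chi * om ^ t] has conductor f or f * q, according to whether om ^ t is
   trivial. *)
Lemma twist_exists chi f t : primitive_character f chi -> coprime f p ->
  exists phi F, [/\ primitive_character F phi, (f %| F)%N, (F %| f * p ^ 2)%N
    & forall a, ~~ (p%:Z %| a)%Z -> phi a = chi a * om a ^ t].
Proof.
move=> hchi cop.
have [triv|] := pselect (forall a, ~~ (p%:Z %| a)%Z -> om a ^ t = 1).
  exists chi, f; split=> // [|a pa]; first by rewrite dvdn_mulr.
  by rewrite triv // mulr1.
move=> /existsNP[a] /not_implyP[pa /eqP oma].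
exists (fun a => chi a * teich_pow t a), (f * q)%N; split.
- apply: primitive_prod hchi (teich_pow_primitive pa oma).
  by apply: (coprime_dvdr dvdn_teich_modulus_sqr); rewrite coprimeXr.
- exact: dvdn_mulr.
- by rewrite dvdn_pmul2l ?dvdn_teich_modulus_sqr //; have [/dirichlet_gt0] := hchi.
- by move=> b pb; rewrite /teich_pow (negPf pb).
Qed.

(** The defining condition of [twist] fixes the values at all integers prime to [M], and these
    determine a primitive character. *)
Lemma twistE psi k phi F (M : int) : M != 0 -> primitive_character F phi ->
  (forall a, ~~ (p%:Z %| a)%Z -> psi a != 0 -> phi a = psi a * om a ^ k) ->
  (forall a, coprimez a M -> ~~ (p%:Z %| a)%Z && (psi a != 0)) ->
  twist p v psi k = phi.
Proof.
move=> M0 hphi phiE hM; apply: xget_unique; first by split=> //; exists F.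
move=> phi' [[F' hphi'] phi'E]; apply: (primitive_unique M0 hphi' hphi) => a.
by move=> /hM /andP[pa psia]; rewrite phi'E ?phiE.
Qed.

Lemma twist_twist chi f k l phi F : primitive_character f chi -> coprime f p ->
  primitive_character F phi ->
  (forall a, ~~ (p%:Z %| a)%Z -> phi a = chi a * om a ^ (k + l)) ->
  twist p v (twist p v chi k) l = phi.
Proof.
move=> hchi cop hphi phiE; have [hc _] := hchi.
pose M := f%:Z * p%:Z.
have M0 : M != 0.
  by rewrite mulf_eq0 !eqz_nat negb_or -!lt0n (dirichlet_gt0 hc) prime_gt0.
have hM a : coprimez a M -> ~~ (p%:Z %| a)%Z && (chi a != 0).
  rewrite coprimezMr (dirichlet_neq0 hc) andbC => /andP[h ->]; rewrite andbT.
  by rewrite -prime_coprime // coprime_sym.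
have [psi [F' [hpsi _ _ psiE]]] := twist_exists k hchi cop.
have -> : twist p v chi k = psi.
  by apply: (twistE M0 hpsi _ hM) => a pa _; exact: psiE.
apply: (twistE M0 hphi) => [a pa _|a /hM/andP[pa chia]].
  by rewrite phiE // psiE // -mulrA -expfzDr ?teich_neq0.
by rewrite pa psiE // mulf_neq0 // expfz_neq0 ?teich_neq0.
Qed.

(** The source of the interpolation: [om a / a] is a 1-unit, so its [t]-th power is close to 1 when
    [t] is divisible by a high power of [p]. *)
Lemma v_teich_pow_sub t (n L : nat) a : ~~ (p%:Z %| a)%Z ->
  ((p ^ L)%:Z %| t)%Z ->
  v (om a ^ t * a%:~R ^+ n - a%:~R ^ (t + n%:Z)) <= eps L.
Proof.
move=> pa hL; have va := v_unit p_prime hK pa.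
have a0 : a%:~R != 0 :> K by rewrite -(v_eq0 hK) va oner_eq0.
have [_ h] := teichP pa.
have x1 : v (om a / a%:~R - 1) <= eps 1.
  have -> : om a / a%:~R - 1 = a%:~R^-1 * (om a - a%:~R) by field.
  apply: (vM_le hK); first by rewrite (vV hK) va invr1.
  exact: le_trans h v_teich_modulus_le.
have -> : om a ^ t * a%:~R ^+ n - a%:~R ^ (t + n%:Z) =
    a%:~R ^ (t + n%:Z) * ((om a / a%:~R) ^ t - 1).
  rewrite expfzDr // mulrBr mulr1; congr (_ - _).
  have {1}-> : om a = a%:~R * (om a / a%:~R) by field.
  by rewrite exprzMl ?unitfE ?mulf_neq0 ?invr_neq0 ?teich_neq0 // mulrAC.
apply: (vM_le hK); first by rewrite (vXz hK) va exp1rz.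
exact: v_Xz_sub1.
Qed.

End Teichmuller.

(** * Bernoulli polynomials and power sums *)

Section Bernoulli.
Implicit Types (n m : nat) (P Q : {poly rat}).

Lemma size_bernoulli_seq n : size (bernoulli_seq n) = n.
Proof. by elim: n => //= n IH; rewrite size_rcons IH. Qed.

Lemma nth_bernoulli_seq n m : (m < n)%N -> (bernoulli_seq n)`_m = bernoulli m.
Proof.
elim: n => // n IH; rewrite ltnS leq_eqVlt => /predU1P[->//|mn].
by rewrite /= nth_rcons size_bernoulli_seq mn IH.
Qed.

Lemma bernoulli_rec n :
  \sum_(j < n.+1) 'C(n.+1, j)%:R * bernoulli j = (n == 0%N)%:R.
Proof.
rewrite big_ord_recr /= binSn.
rewrite [in X in _ + X]/bernoulli /= nth_rcons size_bernoulli_seq ltnn eqxx.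
rewrite [X in _ + X]mulrC divfK ?pnatr_eq0 // addrC -[RHS]addr0 -addrA; congr (_ + _).
apply/eqP; rewrite addrC subr_eq0; apply/eqP; apply: eq_bigr => j _.
by rewrite nth_bernoulli_seq.
Qed.

Lemma coef_bernoulli_poly n i :
  (bernoulli_poly n)`_i = 'C(n, i)%:R * bernoulli (n - i).
Proof.
by rewrite coef_poly; case: ltnP => // ni; rewrite bin_small // mul0r.
Qed.

Lemma deriv_bernoulli_poly n :
  (bernoulli_poly n.+1)^`() = n.+1%:R *: bernoulli_poly n.
Proof.
apply/polyP => i; rewrite coef_deriv coefZ !coef_bernoulli_poly subSS mulrA.
by rewrite -natrM (mul_bin_diag n.+1) natrM -mulrA (mulr_natl _ i.+1).
Qed.

Lemma bernoulli_poly_0 n : (bernoulli_poly n).[0] = bernoulli n.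
Proof. by rewrite horner_coef0 coef_bernoulli_poly bin0 mul1r subn0. Qed.

(** By symmetry of binomials, the value at 1 is the sum in the Bernoulli recurrence plus its next
    term. *)
Lemma bernoulli_poly_1 n :
  (bernoulli_poly n.+1).[1] = bernoulli n.+1 + (n == 0%N)%:R.
Proof.
rewrite horner_poly (reindex_inj rev_ord_inj) /= big_ord_recr /=.
rewrite subnn subn0 expr1n mulr1 bin0 mul1r addrC; congr (_ + _).
rewrite -bernoulli_rec; apply: eq_bigr => i _; rewrite expr1n mulr1 subSS.
have ni : (i <= n.+1)%N by exact/ltnW.
by rewrite bin_sub // subKn.
Qed.

Lemma eq_poly_deriv P Q : P^`() = Q^`() -> P.[0] = Q.[0] -> P = Q.
Proof.
move=> dPQ PQ0; apply/polyP => -[|i]; first by rewrite -!horner_coef0.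
have := congr1 (fun S : {poly rat} => S`_i) dPQ.
by rewrite !coef_deriv => /eqP; rewrite eqrMn2r //= => /eqP.
Qed.

(** Induction on [n]: differentiation turns the identity into the preceding one, and the constants
    agree because the values at 0 and 1 are known. *)
Lemma bernoulli_polyXD1 n :
  bernoulli_poly n \Po ('X + 1) - bernoulli_poly n = n%:R *: 'X^(n.-1).
Proof.
elim: n => [|n IH]; apply: eq_poly_deriv.
- rewrite scale0r derivB deriv_comp.
  have -> : (bernoulli_poly 0)^`() = 0.
    by apply/polyP => i; rewrite coef_deriv coef_bernoulli_poly mul0r mul0rn coef0.
  by rewrite comp_poly0 mul0r subr0 linear0.
- rewrite scale0r !hornerE horner_comp !hornerE.
  have -> : bernoulli_poly 0 = (bernoulli 0)%:P.
    apply/polyP => i; rewrite coef_bernoulli_poly coefC.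
    by case: i => [|i]; rewrite ?mul1r // bin0n mul0r.
  by rewrite !hornerC subrr.
- rewrite derivB deriv_comp deriv_bernoulli_poly derivD derivX derivC addr0 mulr1.
  by rewrite comp_polyZ -scalerBr IH derivZ derivXn /= scaler_nat.
- rewrite !hornerE horner_comp !hornerE bernoulli_poly_0 bernoulli_poly_1.
  by rewrite addrAC subrr add0r expr0n /=; case: n {IH} => //= n; rewrite mulr0.
Qed.

Lemma bernoulli_polyD1 n x :
  (bernoulli_poly n).[x + 1] - (bernoulli_poly n).[x] = n%:R * x ^+ n.-1.
Proof.
have := congr1 (fun P : {poly rat} => P.[x]) (bernoulli_polyXD1 n).
by rewrite !hornerE horner_comp !hornerE.
Qed.

Lemma sum_pow_bernoulli n m x :
  \sum_(0 <= i < m) n.+1%:R * (x + i%:R) ^+ n =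
  (bernoulli_poly n.+1).[x + m%:R] - (bernoulli_poly n.+1).[x].
Proof.
rewrite (eq_bigr (fun i => (bernoulli_poly n.+1).[x + i.+1%:R]
    - (bernoulli_poly n.+1).[x + i%:R])) => [|i _].
  by rewrite telescope_sumr // addr0.
by rewrite -[i.+1%:R]natr1 addrA bernoulli_polyD1.
Qed.

(** The remainder is kept as a polynomial in [y], which is later bounded uniformly on the unit
    ball. *)
Lemma horner_taylor2 P x :
  exists Q, forall y, P.[x + y] = P.[x] + y * P^`().[x] + y ^+ 2 * Q.[y].
Proof.
elim/poly_ind: P => [|P c [Q hQ]].
  by exists 0 => y; rewrite deriv0 !horner0; ring.
exists ((x%:P + 'X) * Q + (P^`().[x])%:P) => y.
by rewrite derivMXaddC !hornerE hQ; ring.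
Qed.

End Bernoulli.

Lemma sum_dvdn_nat (V : nmodType) d n (G : nat -> V) : (0 < d)%N ->
  \sum_(0 <= a < n * d | (d %| a)%N) G a = \sum_(0 <= b < n) G (b * d)%N.
Proof.
move=> d0; elim: n => [|n IH]; first by rewrite mul0n !big_nil.
rewrite big_nat_recr //= -IH (@big_cat_nat _ _ _ (n * d)) ?leq_pmul2r //=; congr (_ + _).
rewrite big_ltn_cond ?ltn_pmul2r // dvdn_mull // big_nat_cond big1 ?addr0 //.
move=> i /andP[/andP[lo hi] /dvdnP[k ik]].
by move: lo hi; rewrite ik !ltn_pmul2r //; lia.
Qed.

(** * Power sums twisted by a character, and generalized Bernoulli numbers *)

Section PowerSums.
Context (R : realType) (p : nat) (K : closedFieldType) (v : K -> R).
Context (p_prime : prime p) (hK : is_Qpbar p v).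

Local Notation eps L := ((p%:R : R) ^- L).

Lemma v_dirichlet_le1 chi f a : dirichlet_character f chi -> v (chi a) <= 1.
Proof.
move=> hchi; have [cop|ncop] := boolP (coprimez a f%:Z); last first.
  by rewrite (dirichlet_eq0 hchi ncop) (v0 hK).
rewrite (v_root1 hK (n := totient f)) //; last exact: dirichlet_root1 hchi cop.
by rewrite totient_gt0 (dirichlet_gt0 hchi).
Qed.

Lemma v_horner_bounded (P : {poly K}) :
  exists2 C, 0 < C & forall y, v y <= 1 -> v P.[y] <= C.
Proof.
elim/poly_ind: P => [|P c [C C0 hC]].
  by exists 1 => // y _; rewrite horner0 (v0 hK).
exists (C + v c) => [|y hy]; first by rewrite ltr_wpDr ?(v_ge0 hK).
rewrite hornerMXaddC; apply: (vD_le hK); last by rewrite lerDr ltW.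
by rewrite mulrC (le_trans (vM_le hK hy (hC _ hy))) // lerDl (v_ge0 hK).
Qed.

(** Group the terms by residue modulo [F]: after dividing by [F], each class is a sum of powers of
    [a/F + i], which telescopes through Bernoulli polynomials. *)
Lemma sum_dirichlet_pow (g : {rmorphism rat -> K}) phi F n T :
  dirichlet_character F phi ->
  \sum_(0 <= a < T * F) phi a%:Z * a%:R ^+ n =
  F%:R ^+ n / n.+1%:R * \sum_(0 <= a < F) phi a%:Z *
    g ((bernoulli_poly n.+1).[a%:R / F%:R + T%:R]
       - (bernoulli_poly n.+1).[a%:R / F%:R]).
Proof.
move=> hphi; have F0 : F%:R != 0 :> rat.
  by rewrite pnatr_eq0 -lt0n (dirichlet_gt0 hphi).
have FK0 : F%:R != 0 :> K by rewrite (nat_neq0 p_prime hK) ?(dirichlet_gt0 hphi).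
have nK0 : n.+1%:R != 0 :> K by rewrite (nat_neq0 p_prime hK).
rewrite big_nat_mul; under eq_bigr => i _.
  rewrite mulSn -{1}[(i * F)%N]add0n big_addn addnK; over.
rewrite exchange_big /= mulr_sumr; apply: eq_bigr => a _.
rewrite -sum_pow_bernoulli rmorph_sum !mulr_sumr; apply: eq_bigr => i _.
have -> : phi (a + i * F)%N%:Z = phi a%:Z.
  apply: (dirichlet_mod hphi); apply: eqz_modP.
  by exists i%:Z; rewrite PoszD PoszM; ring.
rewrite (rmorphM g) (rmorphXn g) (rmorphD g) (fmorph_div g) !(rmorph_nat g).
rewrite natrD natrM.
have -> : a%:R / F%:R + i%:R = (a%:R + i%:R * F%:R) / F%:R :> K by field.
rewrite expr_div_n; field.
by rewrite expf_neq0 ?FK0 // nat1r nK0.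
Qed.

(** The range may be shifted from 1, ..., F to 0, ..., F - 1 because [phi] vanishes at both 0 and
    [F] when [F > 1]. *)
Lemma gen_bernoulliE (g : {rmorphism rat -> K}) phi F n : g =1 ratr ->
  primitive_character F phi -> (1 < F)%N ->
  gen_bernoulli n phi = F%:R ^+ n.-1 *
    \sum_(0 <= a < F) phi a%:Z * g (bernoulli_poly n).[a%:R / F%:R].
Proof.
move=> gE hphi F1; rewrite /gen_bernoulli (conductorE hphi); congr (_ * _).
have [hF _] := hphi.
rewrite big_nat_recr 1?ltnW //= (dirichlet_eq0 hF) ?mul0r ?addr0; last first.
  by rewrite coprimezE /coprime gcdnn gtn_eqF.
rewrite [RHS]big_ltn 1?ltnW // (dirichlet_eq0 hF) ?mul0r ?add0r; last first.
  by rewrite coprimezE /coprime gcd0n gtn_eqF.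
by apply: eq_bigr => a _; rewrite gE.
Qed.

(* B_(n+1)(x + T) - B_(n+1)(x) = (n + 1) T B_n(x) + O(T^2). *)
Lemma power_sum_gen_bernoulli phi F n : primitive_character F phi ->
  (1 < F)%N -> (0 < n)%N ->
  exists2 C, 0 < C & forall T, (0 < T)%N ->
    v ((T * F)%:R^-1 * \sum_(0 <= a < T * F) phi a%:Z * a%:R ^+ n
       - gen_bernoulli n phi) <= C * v T%:R.
Proof.
move=> hphi F1 n0; have [hF _] := hphi.
have [g gE] := ratr_rmorphism p_prime hK.
have F0 : F%:R != 0 :> K by rewrite (nat_neq0 p_prime hK) // ltnW.
have nK0 : n.+1%:R != 0 :> K by rewrite (nat_neq0 p_prime hK).
have /choice[Q hQ] : forall a : nat, exists Q, forall y : rat,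
    (bernoulli_poly n.+1).[a%:R / F%:R + y] - (bernoulli_poly n.+1).[a%:R / F%:R]
    = y * (n.+1%:R * (bernoulli_poly n).[a%:R / F%:R]) + y ^+ 2 * Q.[y].
  move=> a; have [Q hQ] := horner_taylor2 (bernoulli_poly n.+1) (a%:R / F%:R).
  by exists Q => y; rewrite hQ deriv_bernoulli_poly hornerZ; ring.
(* The error is [T] times the value at [T] of this polynomial, which does not depend on [T]. *)
pose E := (F%:R ^+ n.-1 / n.+1%:R) *:
   \sum_(0 <= a < F) phi a%:Z *: map_poly g (Q a).
have [C C0 hC] := v_horner_bounded E.
exists C => // T T0; have TK0 : T%:R != 0 :> K by rewrite (nat_neq0 p_prime hK).
suff -> : (T * F)%:R^-1 * \sum_(0 <= a < T * F) phi a%:Z * a%:R ^+ n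
    - gen_bernoulli n phi = E.[T%:R] * T%:R.
  by rewrite (vM hK) ler_wpM2r ?(v_ge0 hK) // hC ?(v_nat_le1 hK).
rewrite (sum_dirichlet_pow g _ _ hF) (gen_bernoulliE _ gE hphi F1).
rewrite /E hornerZ horner_sum [RHS]mulrAC !mulr_sumr -sumrB.
apply: eq_bigr => a _; rewrite hornerZ hQ.
rewrite -[T%:R in X in _ = X](rmorph_nat g) horner_map.
rewrite !(rmorphD g, rmorphM g, rmorphXn g, rmorph_nat g) natrM.
move: (n0); case: (n) nK0 => // m mK0 _ /=; rewrite exprS.
by field; rewrite F0 TK0 -?natrD ?nat1r ?mK0.
Qed.

(** The terms with [a = p b] form [phi(p) p^n] times the sum of level [M - 1]; removing them
    produces the Euler factor. *)
Lemma euler_power_sum phi F n N e : primitive_character F phi -> (1 < F)%N ->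
  (0 < n)%N -> (F %| N * p ^ 2)%N -> (0 < N)%N -> 0 < e ->
  exists M0, forall M, (M0 <= M)%N ->
    v ((N * p ^ M)%:R^-1 *
         \sum_(0 <= a < N * p ^ M | ~~ (p %| a)%N) phi a%:Z * a%:R ^+ n
       - (1 - phi p%:Z * p%:R ^+ n.-1) * gen_bernoulli n phi) < e.
Proof.
move=> hphi F1 n0 FN N0 e0; have [hF _] := hphi.
have p0 := prime_gt0 p_prime.
have [C C0 hC] := power_sum_gen_bernoulli hphi F1 n0.
have FK0 : F%:R != 0 :> K by rewrite (nat_neq0 p_prime hK) // ltnW.
have [M1 hM1] : exists M1, forall M, (M1 <= M)%N -> eps M < e / (C / v F%:R).
  by apply: eps_small => //; rewrite !divr_gt0 ?(v_gt0 hK).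
pose S M := \sum_(0 <= a < N * p ^ M) phi a%:Z * a%:R ^+ n.
have hS M : (maxn M1 2 <= M)%N ->
    v ((N * p ^ M)%:R^-1 * S M - gen_bernoulli n phi) < e.
  rewrite geq_max => /andP[M1M M2].
  have /dvdnP[T hT] : (F %| N * p ^ M)%N.
    by apply: dvdn_trans FN _; rewrite dvdn_pmul2l // dvdn_exp2l.
  have T0 : (0 < T)%N.
    have : (0 < N * p ^ M)%N by rewrite muln_gt0 N0 expn_gt0 p0.
    by rewrite hT muln_gt0 => /andP[].
  have := hC _ T0; rewrite -hT => /le_lt_trans; apply.
  have : v T%:R <= eps M / v F%:R.
    rewrite ler_pdivlMr ?(v_gt0 hK) // -(vM hK) -natrM -hT natrM (vM hK) (v_pX hK).
    by rewrite ler_piMl ?(v_nat_le1 hK) // eps_ge0.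
  move=> hTv; apply: (@le_lt_trans _ _ (C / v F%:R * eps M)).
    by rewrite -mulrA ler_pM2l // mulrC.
  by rewrite mulrC -ltr_pdivlMr ?hM1 // divr_gt0 ?(v_gt0 hK).
(* One more than the bound in [hS], which is applied at two consecutive levels; the 2 ensures that
   [F] divides [N * p ^ M]. *)
exists (maxn M1 2).+1 => -[//|M]; rewrite ltnS => hM.
have dec : \sum_(0 <= a < N * p ^ M.+1 | ~~ (p %| a)%N) phi a%:Z * a%:R ^+ n =
    S M.+1 - phi p%:Z * p%:R ^+ n * S M.
  rewrite /S [X in _ = X - _](bigID (fun a => p %| a)%N) /= expnSr mulnA sum_dvdn_nat //.
  rewrite addrAC (_ : \sum_(_ <= b < _) _ = phi p%:Z * p%:R ^+ n * S M) ?subrr ?add0r //.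
  rewrite mulr_sumr; apply: eq_bigr => b _.
  by rewrite PoszM (dirichlet_mul hF) natrM exprMn; ring.
have pK0 : p%:R != 0 :> K by rewrite (nat_neq0 p_prime hK).
have NK0 : N%:R != 0 :> K by rewrite (nat_neq0 p_prime hK).
have -> : (N * p ^ M.+1)%:R^-1 *
         \sum_(0 <= a < N * p ^ M.+1 | ~~ (p %| a)%N) phi a%:Z * a%:R ^+ n
       - (1 - phi p%:Z * p%:R ^+ n.-1) * gen_bernoulli n phi =
   ((N * p ^ M.+1)%:R^-1 * S M.+1 - gen_bernoulli n phi)
   - (phi p%:Z * p%:R ^+ n.-1) * ((N * p ^ M)%:R^-1 * S M - gen_bernoulli n phi).
  rewrite dec; case: (n) n0 => // m _ /=; rewrite !natrM !natrX !exprS.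
  by field; rewrite pK0 NK0 expf_neq0.
apply: (vD_lt hK); first by apply: hS; exact: leqW.
rewrite (vN hK); apply: le_lt_trans (hS _ hM).
apply: (vM_le hK) => //.
apply: (vM_le hK); first exact: v_dirichlet_le1 hF.
by rewrite (vX hK) exprn_ile1 ?(v_ge0 hK) ?(v_nat_le1 hK).
Qed.

End PowerSums.

(** * Sums over blocks of length p^M *)

Section Blocks.
Context (R : realType) (p : nat) (K : closedFieldType) (v : K -> R).
Context (p_prime : prime p) (hK : is_Qpbar p v).

Local Notation eps L := ((p%:R : R) ^- L).

(** Up to [eps L] the sum is [p ^ L * s] copies of the sum over one period of length [p ^ L], and
    the factor [p ^ L] is itself small. *)
Lemma v_sum_block (g : nat -> K) L :
  (forall i j, v (g (j + p ^ L * i)%N - g j) <= eps L) ->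
  (forall j, v (g j) <= 1) ->
  forall m s, v (\sum_(m <= j < m + p ^ (2 * L) * s) g j) <= eps L.
Proof.
move=> hper h1 m s.
have step s' : v (\sum_(m <= j < m + p ^ L * s') g j
    - s'%:R * \sum_(m <= j < m + p ^ L) g j) <= eps L.
  elim: s' => [|s' IH].
    by rewrite muln0 addn0 big_geq // mul0r subr0 (v0 hK) eps_ge0.
  rewrite (@big_cat_nat _ _ _ (m + p ^ L * s')) ?leq_addr //=; last first.
    by rewrite leq_add2l leq_pmul2l ?expn_gt0 ?prime_gt0.
  rewrite mulnS addnA -natr1 mulrDl mul1r.
  rewrite [X in _ + X - _](_ : _ =
      \sum_(m <= j < m + p ^ L) g (j + p ^ L * s')%N); last first.
    by rewrite big_addn addnK.
  rewrite opprD addrACA.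
  apply: (vD_le hK) => //; apply: (v_sum_sub_le hK) => [|j _ _]; last exact: hper.
  exact: eps_ge0.
rewrite mul2n -addnn expnD -mulnA.
have h := step (p ^ L * s)%N.
rewrite -(subrK ((p ^ L * s)%N%:R * \sum_(m <= j < m + p ^ L) g j) (\sum_(_ <= _ < _) _)).
apply: (vD_le hK) => //; rewrite mulrC; apply: (vM_le hK).
  by apply: (v_sum_le hK) => // i _ _.
by apply: (v_nat_le_eps p_prime hK); rewrite dvdn_mulr.
Qed.

Lemma v_sum_sub_close (g : nat -> K) L a m n :
  (forall i j, v (g (j + p ^ L * i)%N - g j) <= eps L) ->
  (forall j, v (g j) <= 1) -> (a <= m)%N -> (a <= n)%N ->
  v (m%:R - n%:R) <= eps (2 * L) ->
  v (\sum_(a <= j < m) g j - \sum_(a <= j < n) g j) <= eps L.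
Proof.
move=> hper h1; wlog nm : m n / (n <= m)%N => [wlog am an|am an].
  by have [?|/ltnW ?] := leqP n m; last rewrite (vBC hK) [in X in _ -> X](vBC hK); exact: wlog.
rewrite -natrB // pmulrn (v_int_le_eps p_prime hK) dvdzE /= => /dvdnP[s hs].
rewrite (@big_cat_nat _ _ _ n) //= addrAC subrr add0r.
have -> : m = (n + p ^ (2 * L) * s)%N by rewrite mulnC -hs subnKC.
exact: v_sum_block.
Qed.

(** The summand of [polygamma] extended by 0 to multiples of [p], which makes it nearly periodic
    modulo [p ^ L] on all integers. *)
Definition unit_pow (z : int) (j : nat) : K :=
  if (p %| j)%N then 0 else j%:R ^ z.

Lemma v_unit_pow z j : v (unit_pow z j) <= 1.
Proof.
rewrite /unit_pow; case: ifPn => pj; first by rewrite (v0 hK).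
by rewrite (vXz hK) (v_unit_nat p_prime hK pj) exp1rz.
Qed.

Lemma v_unit_pow_period z L i j : (0 < L)%N ->
  v (unit_pow z (j + p ^ L * i)%N - unit_pow z j) <= eps L.
Proof.
move=> L0; rewrite /unit_pow dvdn_addl; last by rewrite dvdn_mulr // dvdn_exp.
case: ifPn => pj; first by rewrite subr0 (v0 hK) eps_ge0.
apply: (v_subXz_le hK); rewrite ?(v_unit_nat p_prime hK) //.
  by rewrite dvdn_addl // dvdn_mulr // dvdn_exp.
by rewrite natrD addrAC subrr add0r (v_nat_le_eps p_prime hK) // dvdn_mulr.
Qed.

(** Convergence with an explicit rate: by near periodicity, partial sums whose ends agree modulo
    [p ^ (2 * L)] differ by at most [eps L]. *)
Lemma v_polygamma_sub r z L m :
  (forall M, exists2 n, (0 < n)%N & v (n%:R - z) <= eps M) ->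
  (0 < L)%N -> (0 < m)%N -> v (m%:R - z) <= eps (2 * L) ->
  v (\sum_(1 <= k < m) unit_pow (- (r + 1)) k - polygamma p v r z) <= eps L.
Proof.
move=> hz; pose S m := \sum_(1 <= k < m) unit_pow (- (r + 1)) k.
have hS M m1 m2 : (0 < M)%N -> (0 < m1)%N -> (0 < m2)%N ->
    v (m1%:R - z) <= eps (2 * M) -> v (m2%:R - z) <= eps (2 * M) ->
    v (S m1 - S m2) <= eps M.
  move=> M0 m10 m20 h1 h2; apply: v_sum_sub_close => // [i j|j|].
  - exact: v_unit_pow_period.
  - exact: v_unit_pow.
  - by apply: (v_trans hK h1); rewrite (vBC hK).
have [g gE] := ratr_rmorphism p_prime hK.
have /choice[a ha] : forall M, exists n, (0 < n)%N /\ v (n%:R - z) <= eps M.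
  by move=> M; have [n ? ?] := hz M; exists n.
(* Completeness is assumed for rational sequences, so the partial sums are first formed over the
   rationals. *)
pose u M : rat := \sum_(1 <= k < a M | ~~ (p %| k)%N) k%:R ^ (- (r + 1)).
have uE M : ratr (u M) = S (a M).
  rewrite -gE rmorph_sum /= big_mkcond; apply: eq_bigr => k _.
  rewrite /unit_pow if_neg; case: ifP => // _; case: (- (r + 1)) => n.
    by rewrite (rmorphXn g) rmorph_nat.
  by rewrite NegzE -!exprnN (fmorphV g) (rmorphXn g) rmorph_nat.
have haM M M' : (M <= M')%N -> v ((a M')%:R - z) <= eps M.
  by move=> MM'; have [_ h] := ha M'; apply: le_trans h (le_eps R p_prime MM').
have a0 M : (0 < a M)%N by have [] := ha M.
have [|l hl] := Qpbar_complete hK (u := u).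
  move=> e e0; have [M hM] := eps_small p_prime e0.
  exists (2 * M.+1)%N => m1 m2 hm1 hm2; rewrite !uE.
  by apply: le_lt_trans (hM _ (leqnSn M)); apply: hS => //; exact: haM.
have hSl M m1 : (0 < M)%N -> (0 < m1)%N -> v (m1%:R - z) <= eps (2 * M) ->
    v (S m1 - l) <= eps M.
  move=> M0 m10 h; have [M' hM'] := hl _ (eps_gt0 R p_prime M).
  pose M2 := maxn M' (2 * M); apply: (@v_trans _ _ _ _ hK _ (S (a M2))).
    by apply: hS => //; apply: haM; rewrite leq_maxr.
  by rewrite -uE ltW // hM' // leq_maxl.
suff -> : polygamma p v r z = l by exact: hSl.
apply: (plimE p_prime hK hz) => e e0; have [M hM] := eps_small p_prime e0.
exists (eps (2 * M.+1)) => [|n n0 /ltW hn]; first exact: eps_gt0.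
rewrite big_mkcond; apply: le_lt_trans (hM _ (leqnSn M)).
under eq_bigr => k _ do rewrite if_neg; exact: hSl.
Qed.

(** * Teichmuller twists of power sums along residue classes *)

Local Notation W := (teich_pow p v).

(** The values depend on residues modulo [q], which divides [p ^ 2]; hence the bound [1 < L]. *)
Lemma teich_pow_mod t a b L : (1 < L)%N -> (a = b %[mod (p ^ L)%:Z])%Z ->
  W t a = W t b.
Proof.
move=> L1 ab; apply: (dirichlet_mod (teich_pow_dirichlet p_prime hK t)).
apply/eqP; rewrite eqz_mod_dvd; apply: (@dvdz_trans (p ^ L)%N).
  rewrite dvdzE /=; apply: dvdn_trans (dvdn_teich_modulus_sqr p) _.
  by rewrite dvdn_exp2l.
by rewrite -eqz_mod_dvd; exact/eqP.
Qed.

Lemma v_teich_monomial_period t n L i j : (1 < L)%N ->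
  v (W t (j + p ^ L * i)%N * (j + p ^ L * i)%:R ^+ n - W t j * j%:R ^+ n)
    <= eps L.
Proof.
move=> L1; rewrite (@teich_pow_mod t _ j L L1); last first.
  by apply: eqz_modP; exists i%:Z; rewrite PoszD PoszM; ring.
rewrite -mulrBr; apply: (vM_le hK); first exact: v_teich_pow.
apply: (v_subX_le hK); rewrite ?(v_nat_le1 hK) //.
by rewrite natrD addrAC subrr add0r (v_nat_le_eps p_prime hK) // dvdn_mulr.
Qed.

Lemma v_teich_monomial t n j : v (W t j%:Z * j%:R ^+ n) <= 1.
Proof.
apply: (vM_le hK); first exact: v_teich_pow.
by rewrite (vX hK) exprn_ile1 ?(v_ge0 hK) ?(v_nat_le1 hK).
Qed.

(* With a = k + i N = N (i + m) - p^(2L) c, the sum over the residue class of k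
   becomes a sum over j = i + m in [m, m + p^(2L)), where first order Taylor
   expansions at N j apply. *)
Lemma residue_class_sum t n L N m c k : (1 < L)%N ->
  (N * m = k + p ^ (2 * L) * c)%N ->
  v (\sum_(0 <= i < p ^ (2 * L)) W t (k + i * N)%N * (k + i * N)%:R ^+ n.+1
     - (\sum_(0 <= j < p ^ (2 * L)) W t (N * j)%N * (N * j)%:R ^+ n.+1
        + n.+1%:R * N%:R ^+ n.+1 * W t N * (p ^ (2 * L))%:R
          * \sum_(0 <= j < m) W t j * j%:R ^+ n)) <= eps (3 * L).
Proof.
move=> L1 hm; set P := (p ^ (2 * L))%N.
have L2 : (1 < 2 * L)%N by rewrite (leq_trans L1) // leq_pmull.
have vP : v P%:R <= eps (2 * L) by rewrite (v_pX hK).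
(* Second order errors have size [eps (4 * L)]. The tolerance [eps (3 * L)] leaves [eps L] after the
   later division by [p ^ (2 * L)]. *)
have eps4 : eps (2 * L) ^+ 2 <= eps (3 * L).
  by rewrite expr2 -epsD; apply: le_eps => //; lia.
have vP2 x : v x <= eps (2 * L) -> v x ^+ 2 <= eps (3 * L).
  by move=> h; apply: le_trans eps4; rewrite lerXn2r ?nnegrE ?(v_ge0 hK) ?eps_ge0.
have WM a b : W t (a * b)%N%:Z = W t a%:Z * W t b%:Z.
  by rewrite PoszM (dirichlet_mul (teich_pow_dirichlet p_prime hK t)).
pose g j := W t j%:Z * j%:R ^+ n.
pose H j := W t (N * j)%N%:Z * (N * j)%:R ^+ n.+1.
pose D : K := n.+1%:R * N%:R ^+ n * W t N * (P * c)%:R.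
have shift F : \sum_(0 <= i < P) F (i + m)%N = \sum_(m <= j < m + P) F j :> K.
  by rewrite -{2}[m]add0n [RHS]big_addn addnC addnK.
(* Taylor expansion at [N * j] with increment [- (P * c)]; the twist is unchanged by this shift. *)
have h1 : v (\sum_(0 <= i < P) W t (k + i * N)%N * (k + i * N)%:R ^+ n.+1
    - (\sum_(m <= j < m + P) H j - D * \sum_(m <= j < m + P) g j)) <= eps (3 * L).
  rewrite -!shift mulr_sumr -sumrB.
  apply: (v_sum_sub_le hK) => [|i _ _]; first exact: eps_ge0.
  have -> : W t (k + i * N)%N = W t (N * (i + m))%N.
    apply: (teich_pow_mod _ L2); apply: eqz_modP; exists (- c%:Z).
    by rewrite mulnDr hm !PoszD !PoszM; ring.
  have -> : (k + i * N)%:R = (N * (i + m))%:R + - (P * c)%:R :> K.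
    by rewrite mulnDr hm !natrD !natrM; ring.
  have -> : H (i + m)%N - D * g (i + m)%N = W t (N * (i + m))%N *
      ((N * (i + m))%:R ^+ n.+1 + n.+1%:R * (N * (i + m))%:R ^+ n * - (P * c)%:R).
    by rewrite /H /D /g WM !(natrM _ N) !exprMn; ring.
  rewrite -mulrBr; apply: (vM_le hK); first exact: v_teich_pow.
  apply: le_trans (v_taylorX hK _ _ _) _; rewrite ?(vN hK) ?(v_nat_le1 hK) //.
  by apply: vP2; rewrite natrM mulrC; apply: (vM_le hK); rewrite ?(v_nat_le1 hK).
(* The linear term is negligible: [D] contributes [eps (2 * L)], and the sum over a block of length
   [P] another [eps L]. *)
have h2 : v (D * \sum_(m <= j < m + P) g j) <= eps (3 * L).
  have -> : (3 * L = 2 * L + L)%N by lia.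
  rewrite (vM hK) epsD; apply: ler_pM; rewrite ?(v_ge0 hK) //.
    rewrite /D; apply: (vM_le hK); last first.
      by rewrite natrM mulrC; apply: (vM_le hK); rewrite ?(v_nat_le1 hK).
    rewrite (vM hK) mulr_ile1 ?(v_ge0 hK) ?(v_teich_pow p_prime hK) // -natrX -natrM.
    exact: (v_nat_le1 hK).
  rewrite -[P]muln1; apply: v_sum_block => [i j|j]; last exact: v_teich_monomial.
  exact: v_teich_monomial_period.
(* Sliding the window from [[m, m + P)] to [[0, P)] costs the differences [H (j + P) - H j] for
   [j < m]; expanding them to first order gives the main term. *)
have h3 : v (\sum_(m <= j < m + P) H j - (\sum_(0 <= j < P) H j +
    n.+1%:R * N%:R ^+ n.+1 * W t N * P%:R * \sum_(0 <= j < m) g j)) <= eps (3 * L).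
  have -> : \sum_(m <= j < m + P) H j =
      \sum_(0 <= j < P) H j + \sum_(0 <= j < m) (H (j + P)%N - H j).
    rewrite sumrB; apply/eqP; rewrite -(subr_eq0 (\sum_(m <= _ < _) _)).
    have e1 : \sum_(0 <= j < m + P) H j =
        \sum_(0 <= j < m) H j + \sum_(m <= j < m + P) H j.
      by rewrite (@big_cat_nat _ _ _ m) ?leq_addr.
    have e2 : \sum_(0 <= j < m + P) H j =
        \sum_(0 <= j < P) H j + \sum_(0 <= j < m) H (j + P)%N.
      rewrite (@big_cat_nat _ _ _ P) ?leq_addl //=; congr (_ + _).
      by rewrite -{1}[P]add0n [LHS]big_addn addnK.
    have -> : \sum_(m <= j < m + P) H j =
      \sum_(0 <= j < P) H j + \sum_(0 <= j < m) H (j + P)%N - \sum_(0 <= j < m) H j.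
      by rewrite -e2 e1 addrAC subrr add0r.
    by apply/eqP; ring.
  rewrite opprD addrACA subrr add0r mulr_sumr.
  apply: (v_sum_sub_le hK) => [|j _ _]; first exact: eps_ge0.
  have -> : H (j + P)%N = W t (N * j)%N * ((N * j)%:R + (N * P)%:R) ^+ n.+1.
    rewrite /H mulnDr natrD; congr (_ * _); apply: (teich_pow_mod _ L2).
    by apply: eqz_modP; exists N%:Z; rewrite PoszD !PoszM; ring.
  have -> : W t (N * j)%N * ((N * j)%:R + (N * P)%:R) ^+ n.+1 - H j -
      n.+1%:R * N%:R ^+ n.+1 * W t N * P%:R * g j =
    W t (N * j)%N * (((N * j)%:R + (N * P)%:R) ^+ n.+1 -
      ((N * j)%:R ^+ n.+1 + n.+1%:R * (N * j)%:R ^+ n * (N * P)%:R)).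
    by rewrite /H /g WM !(natrM _ N) !exprS !exprMn; ring.
  apply: (vM_le hK); first exact: v_teich_pow.
  apply: le_trans (v_taylorX hK _ _ _) _; rewrite ?(v_nat_le1 hK) //.
  by apply: vP2; rewrite natrM; apply: (vM_le hK); rewrite ?(v_nat_le1 hK).
apply: (v_trans hK h1); rewrite addrAC; apply: (vD_le hK h3).
by rewrite (vN hK).
Qed.

(** The full-window sum [H0] is the same for every class [k], so the vanishing of the sum of [chi]
    removes it. *)
Lemma character_power_sum chi f t n L N (m c : nat -> nat) :
  dirichlet_character f chi -> (f %| N)%N ->
  \sum_(0 <= k < N) chi k%:Z = 0 -> (1 < L)%N ->
  (forall k, (N * m k = k + p ^ (2 * L) * c k)%N) ->
  v (\sum_(0 <= a < N * p ^ (2 * L)) chi a%:Z * (W t a * a%:R ^+ n.+1)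
     - n.+1%:R * N%:R ^+ n.+1 * W t N * (p ^ (2 * L))%:R
       * \sum_(0 <= k < N) chi k%:Z * \sum_(0 <= j < m k) W t j * j%:R ^+ n)
    <= eps (3 * L).
Proof.
move=> hchi fN sum0 L1 hm; rewrite mulnC big_nat_mul.
under eq_bigr => i _.
  rewrite mulSn -{1}[(i * N)%N]add0n big_addn addnK; over.
rewrite exchange_big /=; set A := _ * _%:R; set H0 : K :=
  \sum_(0 <= j < p ^ (2 * L)) W t (N * j)%N * (N * j)%:R ^+ n.+1.
have -> : A * \sum_(0 <= k < N) chi k%:Z * \sum_(0 <= j < m k) W t j * j%:R ^+ n
    = \sum_(0 <= k < N) chi k%:Z * (H0 + A * \sum_(0 <= j < m k) W t j * j%:R ^+ n).
  under [RHS]eq_bigr => k _ do rewrite mulrDr.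
  rewrite big_split /= -mulr_suml sum0 mul0r add0r mulr_sumr.
  by apply: eq_bigr => k _; rewrite mulrCA.
apply: (v_sum_sub_le hK) => [|k _ _]; first exact: eps_ge0.
rewrite (eq_bigr (fun i => chi k%:Z *
    (W t (k + i * N)%N * (k + i * N)%:R ^+ n.+1))) => [|i _]; last first.
  congr (_ * _); apply: (dirichlet_mod hchi); apply: eqz_modP.
  have /dvdnP[d ->] := fN; exists (i%:Z * d%:Z).
  by rewrite PoszD !PoszM; ring.
rewrite -mulr_sumr -mulrBr; apply: (vM_le hK).
  exact (v_dirichlet_le1 hK _ hchi).
exact: residue_class_sum.
Qed.

End Blocks.

(** * Interpolation *)

Lemma coprime_solve N P k : coprime N P -> (0 < N)%N -> (0 < P)%N ->
  exists mc : nat * nat, (0 < mc.1)%N /\ (N * mc.1 = k + P * mc.2)%N.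
Proof.
move=> cop N0 P0; have /(coprimeP _ N0)[[a b] /= hab] := cop.
have {}hab : (a * N = 1 + b * P)%N by lia.
(* Adding [P] and [N] to the Bezout solution preserves the equation and makes the first component
   positive, even for [k = 0]. *)
exists (k * a + P, k * b + N)%N; split; first by rewrite addn_gt0 P0 orbT.
by rewrite /= mulnDr mulnCA [(N * a)%N]mulnC hab; lia.
Qed.

Section Interpolation.
Context (R : realType) (p : nat) (K : closedFieldType) (v : K -> R).
Context (p_prime : prime p) (hK : is_Qpbar p v).
Context (chi : int -> K) (f : nat) (chi_prim : primitive_character f chi).
Context (f_gt1 : (1 < f)%N) (f_p : coprime f p).
Context (N : nat) (N_gt0 : (0 < N)%N) (N_p : coprime N p) (f_N : (f %| N)%N).

Local Notation eps L := ((p%:R : R) ^- L).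
Local Notation W := (teich_pow p v).

Lemma p_ndvd_N : ~~ (p %| N)%N.
Proof. by rewrite -prime_coprime // coprime_sym. Qed.

Lemma v_N : v N%:R = 1.
Proof. exact: (v_unit_nat p_prime hK p_ndvd_N). Qed.

(** Two evaluations of one power sum over integers prime to [p] are compared: through Bernoulli
    numbers with the Euler factor, and through residue classes modulo [N]. *)
Lemma gen_bernoulli_limit phi F t n e : primitive_character F phi ->
  (f %| F)%N -> (F %| f * p ^ 2)%N ->
  (forall a, ~~ (p%:Z %| a)%Z -> phi a = chi a * teichmuller p v a ^ t) ->
  0 < e ->
  exists L0, forall L m c, (L0 <= L)%N ->
    (forall k, (N * m k = k + p ^ (2 * L) * c k)%N) ->
    v ((1 - phi p%:Z * p%:R ^+ n) * gen_bernoulli n.+1 phi / n.+1%:R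
       - N%:R ^+ n * W t N *
         \sum_(0 <= k < N) chi k%:Z * \sum_(0 <= j < m k) W t j * j%:R ^+ n) < e.
Proof.
move=> hphi fF Ff phiE e0; have [hF _] := hphi; have [hchi _] := chi_prim.
have F1 : (1 < F)%N by rewrite (leq_trans f_gt1) // dvdn_leq // (dirichlet_gt0 hF).
have FN : (F %| N * p ^ 2)%N by apply: dvdn_trans Ff _; rewrite dvdn_mul.
have n0 : n.+1%:R != 0 :> K by rewrite (nat_neq0 p_prime hK).
(* The tolerance is scaled to absorb the final division by [n.+1]. *)
have e1 : 0 < e * v n.+1%:R by rewrite mulr_gt0 ?(v_gt0 hK).
have [M0 hM0] := euler_power_sum p_prime hK hphi F1 (ltn0Sn n) FN N_gt0 e1.
have [L1 hL1] := eps_small p_prime e1.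
exists (maxn M0 (maxn L1 2)) => L m c; rewrite !geq_max => /and3P[LM LL L2] hm.
have LM2 : (M0 <= 2 * L)%N by rewrite (leq_trans LM) // leq_pmull.
set P := (p ^ (2 * L))%N in hm *.
set Sg := \sum_(0 <= k < N) _.
have PK0 : P%:R != 0 :> K by rewrite (nat_neq0 p_prime hK) ?expn_gt0 ?prime_gt0.
have NK0 : N%:R != 0 :> K by rewrite (nat_neq0 p_prime hK).
have h1 := hM0 _ LM2; rewrite -/P /= in h1.
have eqS : \sum_(0 <= a < N * P | ~~ (p %| a)%N) phi a%:Z * a%:R ^+ n.+1 =
    \sum_(0 <= a < N * P) chi a%:Z * (W t a * a%:R ^+ n.+1).
  rewrite big_mkcond; apply: eq_bigr => a _; rewrite if_neg /teich_pow.
  have -> : (p%:Z %| a%:Z)%Z = (p %| a)%N by [].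
  by case: ifPn => pa; [rewrite mul0r mulr0|rewrite phiE // mulrA].
have h2 := character_power_sum p_prime hK t n hchi f_N
  (sum_primitive0 chi_prim f_gt1 f_N) L2 hm.
rewrite -/Sg -/P -eqS in h2; set X := \sum_(0 <= a < N * P | _) _ in h1 h2.
(* Dividing by [N * P], with [N] a unit, turns the precision [3 * L] into [L]. *)
have h3 : v ((N * P)%:R^-1 * X - n.+1%:R * N%:R ^+ n * W t N * Sg) < e * v n.+1%:R.
  apply: le_lt_trans (hL1 _ LL).
  have -> : (N * P)%:R^-1 * X - n.+1%:R * N%:R ^+ n * W t N * Sg =
      (N * P)%:R^-1 * (X - n.+1%:R * N%:R ^+ n.+1 * W t N * P%:R * Sg).
    by rewrite natrM exprS; field; rewrite PK0 NK0.
  rewrite (vM hK) (vV hK) natrM (vM hK) v_N mul1r (v_pX hK) invrK mulrC.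
  rewrite -ler_pdivlMr ?exprn_gt0 ?p_gt0 //.
  by rewrite -invfM -exprD -mulSn.
have -> : (1 - phi p%:Z * p%:R ^+ n) * gen_bernoulli n.+1 phi / n.+1%:R -
    N%:R ^+ n * W t N * Sg = n.+1%:R^-1 *
    ((1 - phi p%:Z * p%:R ^+ n) * gen_bernoulli n.+1 phi
     - n.+1%:R * N%:R ^+ n * W t N * Sg).
  by field; rewrite nat1r n0.
rewrite (vM hK) (vV hK) mulrC ltr_pdivrMr ?(v_gt0 hK) //.
by apply: (v_trans_lt hK _ h3); rewrite (vBC hK).
Qed.

(** Since [p ^ A] divides [t], the summands [W t j * j ^+ n] are uniformly close to [j ^ (- r)],
    likewise for [N]; the ends [m k] approximate [k / N] to order [2 * L]. *)
Lemma polygamma_approx t r n A L (m c : nat -> nat) :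
  t + n%:Z = - r -> ((p ^ A)%:Z %| t)%Z -> (A <= L)%N -> (0 < L)%N ->
  (forall k, (0 < m k)%N) ->
  (forall k, (N * m k = k + p ^ (2 * L) * c k)%N) ->
  v (N%:R ^+ n * W t N *
         \sum_(0 <= k < N) chi k%:Z * \sum_(0 <= j < m k) W t j * j%:R ^+ n
     - (N%:R ^ r)^-1 *
         \sum_(1 <= k < N) chi k%:Z * polygamma p v (r - 1) (k%:R / N%:R))
   <= eps A.
Proof.
move=> tn At AL L0 m0 hm; have [hchi _] := chi_prim.
have NK0 : N%:R != 0 :> K by rewrite (nat_neq0 p_prime hK).
have e0 := eps_ge0 R p_prime A.
have -> : \sum_(1 <= k < N) chi k%:Z * polygamma p v (r - 1) (k%:R / N%:R) =
    \sum_(0 <= k < N) chi k%:Z * polygamma p v (r - 1) (k%:R / N%:R).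
  rewrite [RHS]big_ltn // (dirichlet_eq0 hchi) ?mul0r ?add0r //.
  by rewrite coprimezE /coprime gcd0n gtn_eqF.
have close j : v (W t j%:Z * j%:R ^+ n - unit_pow p K (- r) j) <= eps A.
  rewrite /teich_pow /unit_pow; have -> : (p%:Z %| j%:Z)%Z = (p %| j)%N by [].
  case: ifPn => pj; first by rewrite mul0r subr0 (v0 hK).
  by rewrite -tn pmulrn; exact: v_teich_pow_sub.
have hk k : v (\sum_(0 <= j < m k) W t j * j%:R ^+ n -
    polygamma p v (r - 1) (k%:R / N%:R)) <= eps A.
  apply: (v_trans hK (y := \sum_(1 <= j < m k) unit_pow p K (- r) j)).
    have -> : \sum_(1 <= j < m k) unit_pow p K (- r) j =
        \sum_(0 <= j < m k) unit_pow p K (- r) j.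
      by rewrite [RHS]big_ltn // /unit_pow dvdn0 add0r.
    by apply: (v_sum_sub_le hK) => // j _ _; exact: close.
  rewrite -{1}[r](subrK 1); apply: le_trans (le_eps R p_prime AL).
  (* Since [N] is a unit, solutions of the congruence approximate [k / N], which is thus a limit of
     positive integers. *)
  have zE M (m' c' : nat) : (N * m' = k + p ^ M * c')%N ->
      v (m'%:R - k%:R / N%:R) <= eps M.
    move=> h; have -> : m'%:R - k%:R / N%:R = (p ^ M * c')%:R / N%:R :> K.
      have := congr1 (fun x : nat => x%:R : K) h; rewrite natrD natrM => h'.
      by apply: (mulIf NK0); rewrite mulrBl !divfK // mulrC h' addrAC subrr add0r.
    rewrite (vM hK) (vV hK) v_N invr1 mulr1.
    by rewrite (v_nat_le_eps p_prime hK) // dvdn_mulr.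
  apply: (v_polygamma_sub p_prime hK) => // [M|]; last exact: zE (hm k).
  have copM : coprime N (p ^ M) by rewrite coprimeXr.
  have pM0 : (0 < p ^ M)%N by rewrite expn_gt0 prime_gt0.
  have [[m' c'] [/= m'0 h]] := coprime_solve k copM N_gt0 pM0.
  by exists m' => //; exact: zE h.
have hN : v (N%:R ^+ n * W t N - (N%:R ^ r)^-1) <= eps A.
  have := close N; rewrite /unit_pow (negPf p_ndvd_N) mulrC.
  by rewrite invr_expz.
set Sg := \sum_(0 <= k < N) _; set Sp := \sum_(0 <= k < N) _.
apply: (v_trans hK (y := (N%:R ^ r)^-1 * Sg)).
  rewrite -mulrBl mulrC; apply: (vM_le hK) => //.
  apply: (v_sum_le hK) => // k _ _; apply: (vM_le hK).
    exact: (v_dirichlet_le1 hK _ hchi).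
  apply: (v_sum_le hK) => // j _ _; exact: v_teich_monomial.
rewrite -mulrBr; apply: (vM_le hK).
  by rewrite (vV hK) (vXz hK) v_N exp1rz invr1.
apply: (v_sum_sub_le hK) => // k _ _; rewrite -mulrBr; apply: (vM_le hK) => //.
exact: (v_dirichlet_le1 hK _ hchi).
Qed.

End Interpolation.

(** * Passage to the limit *)

Theorem theorem2p5 (R : realType) (p : nat) (K : closedFieldType) (v : K -> R)
    (p_prime : prime p) (hK : is_Qpbar p v)
    (chi : int -> K) (f : nat) (chi_prim : primitive_character f chi)
    (f_gt1 : (1 < f)%N) (f_p : coprime f p)
    (N : nat) (N_gt0 : (0 < N)%N) (N_p : coprime N p) (f_N : (f %| N)%N)
    (r : int) :
  Lp p v (twist p v chi (1 - r)) r%:~R =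
  - (N%:R ^ r)^-1 *
    \sum_(1 <= k < N) chi k%:Z * polygamma p v (r - 1) (k%:R / N%:R).
Proof.
have zE (n : nat) : n%:R - (1 - r%:~R) = (n%:Z - 1 + r)%:~R :> K.
  by rewrite rmorphD rmorphB /= -pmulrn; ring.
apply: (plimE p_prime hK) => [L|e e0].
  (* A positive integer close to [1 - r]: adding [p ^ L] times the absolute value of [r] outweighs
     [- r]. *)
  have pos : 0 < 1 - r + (p ^ L)%:Z * `|r|%N%:Z.
    have pL : 1 <= (p ^ L)%:Z by rewrite lez_nat expn_gt0 prime_gt0.
    nia.
  exists (absz (1 - r + (p ^ L)%:Z * `|r|%N%:Z)); first by rewrite absz_gt0 gt_eqF.
  rewrite zE (v_int_le_eps p_prime hK) gez0_abs ?ltW //.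
  have -> : 1 - r + (p ^ L)%:Z * `|r|%N%:Z - 1 + r = (p ^ L)%:Z * `|r|%N%:Z by ring.
  exact: dvdz_mulr.
have [A hA] := eps_small p_prime e0.
exists ((p%:R : R) ^- A) => [|[//|n] _]; first exact: eps_gt0.
rewrite zE => /ltW; rewrite (v_int_le_eps p_prime hK) => hn.
(* The running integer of the limit is [n.+1], so this is the total exponent [(1 - r) - n.+1] of the
   Teichmuller character. *)
pose t : int := - r - n%:Z.
have At : ((p ^ A)%:Z %| t)%Z.
  have -> : t = - (n.+1%:Z - 1 + r) by rewrite /t; lia.
  by rewrite rpredN.
have tn : t + n%:Z = - r by rewrite /t; ring.
have [phi [F [hphi fF Ff phiE]]] := twist_exists p_prime hK t chi_prim f_p.
have -> : twist p v (twist p v chi (1 - r)) (- n.+1%:Z) = phi.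
  apply: (twist_twist p_prime hK chi_prim f_p hphi) => a pa.
  by rewrite phiE //; congr (_ * _ ^ _); rewrite /t; lia.
have [L0 hL0] := gen_bernoulli_limit p_prime hK chi_prim f_gt1 N_gt0 N_p f_N n
  hphi fF Ff phiE e0.
(* Only the intermediate sum depends on [L], [m] and [c]; [L] is taken large enough for both of its
   estimates. *)
pose L := maxn L0 (maxn A 1).
have pL0 : (0 < p ^ (2 * L))%N by rewrite expn_gt0 prime_gt0.
have copL : coprime N (p ^ (2 * L)) by rewrite coprimeXr.
have /choice[mc hmc] := fun k => coprime_solve k copL N_gt0 pL0.
pose m k := (mc k).1; pose c k := (mc k).2.
have m0 k : (0 < m k)%N by have [] := hmc k.
have hm k : (N * m k = k + p ^ (2 * L) * c k)%N by have [] := hmc k.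
have h1 := hL0 L m c (leq_maxl _ _) hm.
have AL : (A <= L)%N by rewrite /L maxnCA leq_maxl.
have L_gt0 : (0 < L)%N by rewrite /L maxnA leq_maxr.
have h2 := polygamma_approx p_prime hK chi_prim f_gt1 N_gt0 N_p tn At AL L_gt0 m0 hm.
rewrite -(vN hK) /= !mulNr !opprD !opprK.
apply: (v_trans_lt hK h1); exact: le_lt_trans h2 (hA _ (leqnn A)).
Qed.
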